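(* For every $\pi\in S(\mathbb{Z}_{25})$ there exist a subset $A\subseteq\mathbb{Z}_{25}$ with $2\leq|A|\leq 7$ and an element $i\in\mathbb{Z}_{25}$ such that $\pi(A)=A+i$. Moreover, there exist $\pi\in S(\mathbb{Z}_{25})$ such that $x\mapsto\pi(x)-x$ is a permutation of $\mathbb{Z}_{25}$ and, for every $k\in\mathbb{Z}_{25}$, the permutation $x\mapsto\pi(x+k)$ has no cycle of length $2,3,4,5$ or $6$.
   Context: $S(\mathbb{Z}_n)$ denotes the set of bijections $\mathbb{Z}_n\to\mathbb{Z}_n$; $A+i=\{a+i:a\in A\}$. *)

(* Defs.v *)
From mathcomp Require Import all_boot all_order all_algebra all_fingroup.
Set Implicit Arguments. Unset Strict Implicit. Unset Printing Implicit Defensive.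
Import GRing.Theory.
Local Open Scope ring_scope.

Definition Z25 := 'Z_25.

Definition translate (A : {set Z25}) (i : Z25) : {set Z25} := [set a + i | a in A].

Definition shifted (pi : {perm Z25}) (k : Z25) : Z25 -> Z25 := fun x => pi (x + k).

Definition no_short_cycle (f : Z25 -> Z25) : Prop :=
  forall x : Z25, ~ (2 <= fingraph.order f x <= 6)%N.

(* Main.v *)
Require Import Defs.
From HB Require Import structures.
From mathcomp Require Import all_boot all_order all_algebra all_fingroup.
From mathcomp Require Import zify ring.
From Stdlib Require Import Strings.Byte.
Import GRing.Theory.
Set Implicit Arguments.
Unset Strict Implicit.
Unset Printing Implicit Defensive.
Local Open Scope nat_scope.


(** Suppose that no set of 2 to 7 elements works for a permutation p. A set A satisfies p(A) = A + i
    exactly when it is stable under z -> p(z) - i. So no such map has a cycle of length 2 to 7 or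
    two fixed points. Two fixed points for one i are two points with the same p(x) - x, and a
    2-cycle is a pair with the same x + p(x). Hence the graph of p solves the toroidal queens
    problem on the 25 x 25 board and has, in addition, no cycle of length 3 to 7 for any i. This is
    [good], obtained in [good_perm]; the first half of the theorem follows from [no_good].

    Reduce the cells modulo 5, which gives 25 boxes. Each residue class of rows, columns, diagonals
    and antidiagonals contains five queens, so the box counts form a 5 x 5 matrix of natural numbers
    whose lines modulo 5 all have sum 5 ([class_sum]). If no entry vanishes, all entries are 1
    ([balanced_ones]). Otherwise a translation moves a zero to the origin, and the entry at (a, b)
    becomes f(b - 2 a) + g(b + 2 a) with f(0) = g(0) = 0, where the eight other values are natural
    numbers of sum 5 ([balanced_vector]). A finite check ([classP]) brings each of these matrices to
    one of 22 listed types by affine maps with a common multiplier and transposition, and these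
    symmetries preserve goodness ([symmetric_copy]).

    For each of the 23 types a queen can be assumed at a chosen cell ([infeasible_corner]), and the
    rest is exhaustive search. A certificate branches on a line or box that must still receive a
    queen ([line_cell]). Each unattacked cell there is either explored or dismissed, because it
    closes a short cycle, overfills its box, or completes a symmetric image of a configuration
    refuted before. The search is not trusted: [check_sound] shows that an accepted certificate
    excludes every good completion.

    For the second half an explicit permutation is tested against all shifts ([witness_diff],
    [witness_cycles]). *)

(** * Table arithmetic of Z/25, subsets as bit masks, and board states *)

Inductive z25 : Set :=
  z0 | z1 | z2 | z3 | z4 | z5 | z6 | z7 | z8 | z9 | z10 | z11 | z12 | z13 |
  z14 | z15 | z16 | z17 | z18 | z19 | z20 | z21 | z22 | z23 | z24.

Inductive dig : Set :=
  d0 | d1 | d2 | d3 | d4 | d5 | d6 | d7 | d8 | d9 | d10 | d11 | d12 | d13 |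
  d14 | d15 | d16 | d17 | d18 | d19 | d20 | d21 | d22 | d23 | d24 | d25 |
  d26 | d27 | d28 | d29 | d30 | d31.

Definition zs : seq z25 :=
  [:: z0; z1; z2; z3; z4; z5; z6; z7; z8; z9; z10; z11; z12; z13; z14; z15; z16;
  z17; z18; z19; z20; z21; z22; z23; z24].

Definition ds : seq dig :=
  [:: d0; d1; d2; d3; d4; d5; d6; d7; d8; d9; d10; d11; d12; d13; d14; d15; d16;
  d17; d18; d19; d20; d21; d22; d23; d24; d25; d26; d27; d28; d29; d30; d31].

Definition ton (z : z25) : nat :=
  match z with
  z0 => 0 | z1 => 1 | z2 => 2 | z3 => 3 | z4 => 4 | z5 => 5 | z6 => 6 |
  z7 => 7 | z8 => 8 | z9 => 9 | z10 => 10 | z11 => 11 | z12 => 12 |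
  z13 => 13 | z14 => 14 | z15 => 15 | z16 => 16 | z17 => 17 | z18 => 18 |
  z19 => 19 | z20 => 20 | z21 => 21 | z22 => 22 | z23 => 23 | z24 => 24
  end.

Definition dton (d : dig) : nat :=
  match d with
  d0 => 0 | d1 => 1 | d2 => 2 | d3 => 3 | d4 => 4 | d5 => 5 | d6 => 6 |
  d7 => 7 | d8 => 8 | d9 => 9 | d10 => 10 | d11 => 11 | d12 => 12 |
  d13 => 13 | d14 => 14 | d15 => 15 | d16 => 16 | d17 => 17 | d18 => 18 |
  d19 => 19 | d20 => 20 | d21 => 21 | d22 => 22 | d23 => 23 | d24 => 24 |
  d25 => 25 | d26 => 26 | d27 => 27 | d28 => 28 | d29 => 29 | d30 => 30 |
  d31 => 31
  end.
(** Turns a function into a table: once normalized, every branch of the match is a literal, so that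
    evaluation is a jump instead of arithmetic on [nat]. *)
Definition case25 {A : Type} (f : z25 -> A) (z : z25) : A :=
  ltac:(pose (r := f z); destruct z; exact r).
Definition case32 {A : Type} (f : dig -> A) (d : dig) : A :=
  ltac:(pose (r := f d); destruct d; exact r).
Definition case256 {A : Type} (f : byte -> A) (b : byte) : A :=
  ltac:(pose (r := f b); destruct b; exact r).
Definition tab2 {A : Type} (f : z25 -> z25 -> A) (a b : z25) : A :=
  case25 (fun a => case25 (f a) b) a.

Definition ofn (n : nat) : z25 := nth z0 zs (n %% 25).
Definition ofd (n : nat) : dig := nth d0 ds n.
Definition zadd := Eval vm_compute in tab2 (fun a b => ofn (ton a + ton b)).
Definition zsub := Eval vm_compute in tab2 (fun a b => ofn (ton a + (25 - ton b))).
Definition zmul := Eval vm_compute in tab2 (fun a b => ofn (ton a * ton b)).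
Definition zeq := Eval vm_compute in tab2 (fun a b => ton a == ton b).
Definition zdbl := Eval vm_compute in case25 (fun a => ofn (2 * ton a)).
(** 13 is the inverse of 2 modulo 25. *)
Definition zhalf := Eval vm_compute in case25 (fun a => ofn (13 * ton a)).
Definition zopp := Eval vm_compute in case25 (fun a => ofn (25 - ton a)).
Definition zunit := Eval vm_compute in case25 (fun a => ton a %% 5 != 0).
Definition zbox := Eval vm_compute in
  tab2 (fun a b => ofn (5 * (ton a %% 5) + ton b %% 5)).

Inductive p5 (A : Type) : Type := P5 (a b c d e : A).
Arguments P5 {A}.

Definition sel {A : Type} (j : nat) (m : p5 A) : A :=
  let: P5 a b c d e := m in
  match j with 0 => a | 1 => b | 2 => c | 3 => d | _ => e end.
Definition upd {A : Type} (j : nat) (f : A -> A) (m : p5 A) : p5 A :=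
  let: P5 a b c d e := m in
  match j with
  | 0 => P5 (f a) b c d e | 1 => P5 a (f b) c d e | 2 => P5 a b (f c) d e
  | 3 => P5 a b c (f d) e | _ => P5 a b c d (f e)
  end.
Definition mk5 {A : Type} (f : nat -> A) : p5 A :=
  P5 (f 0) (f 1) (f 2) (f 3) (f 4).

Definition res (z : z25) : nat := ton z %% 5.
Definition quo (z : z25) : nat := ton z %/ 5.

(* A map from Z/25, stored as five rows of five. *)
Definition arr (A : Type) := p5 (p5 A).
Definition aget {A : Type} := Eval cbv in
  fun (m : arr A) (z : z25) => case25 (fun z => sel (res z) (sel (quo z) m)) z.
Definition amod {A : Type} := Eval cbv in
  fun (f : A -> A) (m : arr A) (z : z25) =>
  let: P5 a b c d e := m in
  case25 (fun z => upd (quo z) (upd (res z) f) (P5 a b c d e)) z.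
Definition amake {A : Type} (f : z25 -> A) : arr A :=
  mk5 (fun i => mk5 (fun j => f (ofn (5 * i + j)))).

(* A subset of Z/25: the element [5 u + j] is bit [u] of digit [j], so that a
   translation permutes the digits and rotates each of them. *)
Definition mask := p5 dig.
Definition full : mask := P5 d31 d31 d31 d31 d31.
Definition bit (u : nat) (d : dig) : bool := odd (dton d %/ 2 ^ u).
Definition dmake (f : nat -> bool) : dig :=
  ofd (foldr (fun u n => f u * 2 ^ u + n) 0 (iota 0 5)).
Definition mbit := Eval vm_compute in
  fun (z : z25) (m : mask) => let: P5 a b c d e := m in
  case25 (fun z => case32 (bit (quo z)) (sel (res z) (P5 a b c d e))) z.
Definition mclear := Eval vm_compute in
  fun (z : z25) (m : mask) => let: P5 a b c d e := m in
  case25 (fun z =>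
    upd (res z) (case32 (fun d => dmake (fun u => (u != quo z) && bit u d)))
      (P5 a b c d e)) z.

(* [w] intersected with [d] rotated by [p] *)
Definition rland_ (p : nat) (w d : dig) : dig :=
  case32 (fun w => if dton w == 0 then d0 else case32 (fun d =>
    dmake (fun u => bit u w && bit ((u + p) %% 5) d)) d) w.
Definition rland0 := Eval vm_compute in rland_ 0.
Definition rland1 := Eval vm_compute in rland_ 1.
Definition rland2 := Eval vm_compute in rland_ 2.
Definition rland3 := Eval vm_compute in rland_ 3.
Definition rland4 := Eval vm_compute in rland_ 4.
Definition rland (p : nat) : dig -> dig -> dig :=
  match p with
  | 0 => rland0 | 1 => rland1 | 2 => rland2 | 3 => rland3 | _ => rland4
  end.
Definition gate_ (u : nat) (w d : dig) : dig :=
  case32 (fun w => if bit u w then d else d0) w.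

Definition digz_ (j : nat) (d : dig) (l : seq z25) : seq z25 :=
  case32 (fun d => foldr (fun u l => if bit u d then ofn (5 * u + j) :: l else l)
                    l (iota 0 5)) d.
Definition digz0 := Eval vm_compute in digz_ 0.
Definition digz1 := Eval vm_compute in digz_ 1.
Definition digz2 := Eval vm_compute in digz_ 2.
Definition digz3 := Eval vm_compute in digz_ 3.
Definition digz4 := Eval vm_compute in digz_ 4.
Definition elements (m : mask) : seq z25 :=
  let: P5 a b c d e := m in
  digz0 a (digz1 b (digz2 c (digz3 d (digz4 e [::])))).

(* The directions of the lines that contain exactly one cell of a queens
   solution; a [Box] is a class of cells modulo 5. *)
Inductive dir : Set := Row | Col | Diag | Anti | Box.

(* The free values of x, y, y - x, x + y, x - y, 2 x, 2 y and - 2 x, the partial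
   permutation, and how many cells are still missing in every box. *)
Inductive state : Type :=
  State (mx my md ms me m2x m2y mn2x : mask) (f : arr (option z25)) (nb : arr nat).

Definition place (s : state) (x y : z25) : state :=
  let: State mx my md ms me m2x m2y mn2x f nb := s in
  State (mclear x mx) (mclear y my) (mclear (zsub y x) md) (mclear (zadd x y) ms)
    (mclear (zsub x y) me) (mclear (zdbl x) m2x) (mclear (zdbl y) m2y)
    (mclear (zopp (zdbl x)) mn2x) (amod (fun=> Some y) f x)
    (amod predn nb (zbox x y)).
Definition partial (s : state) : arr (option z25) :=
  let: State _ _ _ _ _ _ _ _ f _ := s in f.
Definition missing (s : state) : arr nat :=
  let: State _ _ _ _ _ _ _ _ _ nb := s in nb.

Definition open_line (s : state) (v : dir) (k : z25) : bool :=
  let: State mx my md ms _ _ _ _ _ nb := s in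
  match v with
  | Row => mbit k mx | Col => mbit k my | Diag => mbit k md | Anti => mbit k ms
  | Box => if aget nb k is 0 then false else true
  end.

(* The unattacked cells of a line. A cell of a row is given by its column, a cell
   of a column by its row, a cell of a diagonal by x + y, a cell of an antidiagonal
   by y - x, and [5 t + s] stands for the cell [(a + 5 s, b + 5 t)] of the box of
   [(a, b)]. *)
Definition alive := Eval cbv -[rland0 rland1 rland2 rland3 rland4] in
  fun (s : state) (v : dir) (k : z25) =>
  let rot (w b e : mask) :=
    let: P5 w0 w1 w2 w3 w4 := w in let: P5 b0 b1 b2 b3 b4 := b in
    let: P5 e0 e1 e2 e3 e4 := e in
    case25 (fun k =>
      let r (h : z25) j (m : mask) wj :=
        rland ((quo h + (j + res h) %/ 5) %% 5) wj (sel ((j + res h) %% 5) m) in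
      let g j wj := r k j (P5 e0 e1 e2 e3 e4)
        (r (ofn (25 - ton k)) j (P5 b0 b1 b2 b3 b4) wj) in
      P5 (g 0 w0) (g 1 w1) (g 2 w2) (g 3 w3) (g 4 w4)) k in
  let: State mx my md ms me m2x m2y mn2x _ _ := s in
  match v with
  | Row => rot my md ms | Col => rot mx me ms
  | Diag => rot ms m2x m2y | Anti => rot md mn2x m2y
  | Box =>
    let: P5 x0 x1 x2 x3 x4 := mx in let: P5 y0 y1 y2 y3 y4 := my in
    let: P5 b0 b1 b2 b3 b4 := md in let: P5 e0 e1 e2 e3 e4 := ms in
    case25 (fun k =>
      let a := quo k in let b := res k in
      let g j := gate_ j (sel a (P5 x0 x1 x2 x3 x4))
        (rland ((j + (a + b) %/ 5) %% 5)
          (rland ((10 - j - (b < a)) %% 5) (sel b (P5 y0 y1 y2 y3 y4))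
             (sel ((b + 5 - a) %% 5) (P5 b0 b1 b2 b3 b4)))
          (sel ((a + b) %% 5) (P5 e0 e1 e2 e3 e4))) in
      mk5 g) k
  end.

Definition boxx := Eval vm_compute in tab2 (fun k t => ofn (quo k + 5 * res t)).
Definition boxy := Eval vm_compute in tab2 (fun k t => ofn (res k + 5 * quo t)).
Definition halfsub := Eval vm_compute in tab2 (fun a b => zhalf (zsub a b)).
Definition halfadd := Eval vm_compute in tab2 (fun a b => zhalf (zadd a b)).
Definition cellx (v : dir) (k t : z25) : z25 :=
  match v with
  | Row => k | Col => t | Diag => halfsub t k | Anti => halfsub k t
  | Box => boxx k t
  end.
Definition celly (v : dir) (k t : z25) : z25 :=
  match v with
  | Row => t | Col => k | Diag => halfadd t k | Anti => halfadd t k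
  | Box => boxy k t
  end.

(** * Refutation certificates and their checker *)

Definition shape := seq (z25 * z25).

(* [z25] coordinates of the image of a cell under a scaling by [u], a possible
   transposition and a translation *)
Definition movex (u tx : z25) (sw : bool) (c : z25 * z25) : z25 :=
  zadd (zmul u (if sw then c.2 else c.1)) tx.
Definition movey (u ty : z25) (sw : bool) (c : z25 * z25) : z25 :=
  zadd (zmul u (if sw then c.1 else c.2)) ty.

(** [Branch] opens a sub-refutation, the other actions dismiss a cell. A cycle of length 2 is an
    attack along an antidiagonal, hence the cycle lengths start at 3. *)
Inductive action : Set :=
  Branch (v : dir) (k : z25) | Cycle3 (i : z25) | Cycle4 (i : z25) | Cycle5 (i : z25)
| Cycle6 (i : z25) | Cycle7 (i : z25) | FullBox | Forbidden (sw : bool).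
Definition decode := Eval vm_compute in case256 (fun b =>
  let n := Byte.to_nat b in
  let z := ofn n in
  match n %/ 25 with
  | 0 => Branch Row z | 1 => Branch Col z | 2 => Branch Diag z | 3 => Branch Anti z
  | 4 => Branch Box z | 5 => Cycle3 z | 6 => Cycle4 z | 7 => Cycle5 z
  | 8 => Cycle6 z | 9 => Cycle7 z
  | _ => if n == 250 then FullBox else Forbidden (n == 252)
  end).
Definition bytez := Eval vm_compute in case256 (fun b => ofn (Byte.to_nat b)).

(** A queen at (x, y) sends x to a = y - i; n further steps along placed queens that end in x make a
    cycle of length n + 1. *)
Fixpoint follow (n : nat) (f : arr (option z25)) (i x a : z25) : bool :=
  if n is n'.+1 then
    if aget f a is Some b then follow n' f i x (zsub b i) else false
  else zeq a x.
Definition follow2 := Eval cbv beta iota delta [follow] in follow 2.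
Definition follow3 := Eval cbv beta iota delta [follow] in follow 3.
Definition follow4 := Eval cbv beta iota delta [follow] in follow 4.
Definition follow5 := Eval cbv beta iota delta [follow] in follow 5.
Definition follow6 := Eval cbv beta iota delta [follow] in follow 6.
Definition occupied (f : arr (option z25)) (x y a b : z25) : bool :=
  if zeq a x then zeq b y else if aget f a is Some c then zeq c b else false.
Fixpoint occupied_all (f : arr (option z25)) (x y u tx ty : z25) (sw : bool)
    (l : shape) : bool :=
  if l is c :: l' then
    if occupied f x y (movex u tx sw c) (movey u ty sw c)
    then occupied_all f x y u tx ty sw l' else false
  else true.

(* Box capacities, given by the box of [(a, b)] at index [5 a + b]. *)
Definition caps := arr nat.
Definition move_box (u a b : nat) (sw : bool) (k : z25) : z25 :=
  let x := quo k in let y := res k in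
  zbox (ofn (u * (if sw then y else x) + a)) (ofn (u * (if sw then x else y) + b)).
Definition preserves (cap : caps) (u a b : nat) (sw : bool) : bool :=
  (u != 0) && all (fun k => aget cap (move_box u a b sw k) == aget cap k) zs.
(** Whether a symmetry preserves the capacities depends only on its multiplier and translation
    modulo 5, so a small table answers for all of them. *)
Definition symmetries (cap : caps) : arr (p5 (bool * bool)) :=
  mk5 (fun a => mk5 (fun b => mk5 (fun u =>
    (preserves cap u a b false, preserves cap u a b true)))).
Definition rsel {A : Type} := Eval cbv in
  fun (z : z25) (m : p5 A) => let: P5 a b c d e := m in
  case25 (fun z => sel (res z) (P5 a b c d e)) z.
Definition sym_ok (st : arr (p5 (bool * bool))) (u tx ty : z25) (sw : bool) : bool :=
  let: (a, b) := rsel u (rsel ty (rsel tx st)) in if sw then b else a.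

Section Checker.
Variables (st : arr (p5 (bool * bool))) (forbidden : seq shape).

(* Consumes a refutation of [s] by a case analysis on the line [(v, k)]. *)
Fixpoint check (n : nat) (s : state) (v : dir) (k : z25) (l : seq byte)
    (next : seq byte -> bool) : bool :=
  if n is n'.+1 then
    if open_line s v k then
      (fix loop (ts : seq z25) (l : seq byte) : bool :=
        if ts is t :: ts' then
          if l is b :: l then
            let x := cellx v k t in let y := celly v k t in
            match decode b with
            (* The refutation of this branch comes next in the stream, and the remaining cells of
               the line are its continuation. *)
            | Branch v k => check n' (place s x y) v k l (loop ts')
            | Cycle3 i => if follow2 (partial s) i x (zsub y i) then loop ts' l else false
            | Cycle4 i => if follow3 (partial s) i x (zsub y i) then loop ts' l else false
            | Cycle5 i => if follow4 (partial s) i x (zsub y i) then loop ts' l else false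
            | Cycle6 i => if follow5 (partial s) i x (zsub y i) then loop ts' l else false
            | Cycle7 i => if follow6 (partial s) i x (zsub y i) then loop ts' l else false
            | FullBox => if aget (missing s) (zbox x y) is 0 then loop ts' l else false
            | Forbidden sw =>
              if l is u :: tx :: ty :: j :: l then
                let u := bytez u in let tx := bytez tx in let ty := bytez ty in
                let sh := nth [::] forbidden (Byte.to_nat j) in
                (* An index out of range yields the empty shape, which would be occupied
                   vacuously. *)
                if sh is [::] then false else
                if sym_ok st u tx ty sw then
                  if occupied_all (partial s) x y u tx ty sw sh then loop ts' l else false
                else false
              else false
            end
          else false
        else next l) (elements (alive s v k)) l
    else false
  else false.
End Checker.

(** Certificates are long; a tree with leaves of 16 bytes keeps the term that stores one shallow. *)
Inductive rope : Set :=
  Leaf16 (a b c d e f g h i j k l m n o p : byte) | Node (l r : rope).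
Fixpoint flat (r : rope) (t : seq byte) : seq byte :=
  match r with
  | Leaf16 a b c d e f g h i j k l m n o p =>
    [:: a, b, c, d, e, f, g, h, i, j, k, l, m, n, o, p & t]
  | Node l r => flat l (flat r t)
  end.

Definition state0 (cap : caps) : state :=
  State full full full full full full full full (amake (fun=> None)) cap.
Definition state_of (cap : caps) (sh : shape) : state :=
  foldr (fun c s => place s c.1 c.2) (state0 cap) sh.
Definition refutes (fuel : nat) (cap : caps) (forbidden : seq shape) (sh : shape) (r : rope) : bool :=
  uniq [seq ton d.1 | d <- sh] &&
  if flat r [::] is b :: l then
    if decode b is Branch v k then
      check (symmetries cap) forbidden fuel (state_of cap sh) v k l xpredT
    else false
  else false.

(** * Correctness of the tables and masks *)

Lemma tonK : cancel ton ofn. Proof. by case. Qed.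
Lemma ton_lt z : ton z < 25. Proof. by case: z. Qed.
Definition zord (z : z25) : 'I_25 := Ordinal (ton_lt z).
Definition ordz (i : 'I_25) : z25 := ofn i.
Lemma zordK : cancel zord ordz. Proof. exact: tonK. Qed.
HB.instance Definition _ := Finite.copy z25 (can_type zordK).
Lemma dtonK : cancel dton ofd. Proof. by case. Qed.
HB.instance Definition _ := Countable.copy dig (can_type dtonK).

Lemma mem_zs z : z \in zs. Proof. by case: z; vm_compute. Qed.
Lemma mem_ds d : d \in ds. Proof. by case: d; vm_compute. Qed.
Lemma uniq_zs : uniq zs. Proof. by vm_compute. Qed.
Lemma brute1 (P : z25 -> bool) : all P zs -> forall z, P z.
Proof. by move=> /allP H z; apply/H/mem_zs. Qed.
Lemma brute2 (P : z25 -> z25 -> bool) :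
  all (fun a => all (P a) zs) zs -> forall a b, P a b.
Proof. by move=> H a; apply: brute1; move: a; apply: brute1. Qed.
Lemma brute3 (P : z25 -> z25 -> z25 -> bool) :
  all (fun a => all (fun b => all (P a b) zs) zs) zs -> forall a b c, P a b c.
Proof. by move=> H a; apply: brute2; move: a; apply: brute1. Qed.

Lemma zeqE a b : zeq a b = (a == b).
Proof. by apply/eqP; move: a b; apply: brute2; vm_compute. Qed.

Lemma zaddC a b : zadd a b = zadd b a.
Proof. by apply/eqP; move: a b; apply: brute2; vm_compute. Qed.
Lemma zaddA a b c : zadd a (zadd b c) = zadd (zadd a b) c.
Proof. by apply/eqP; move: a b c; apply: brute3; vm_compute. Qed.
Lemma zmulDr a b c : zmul a (zadd b c) = zadd (zmul a b) (zmul a c).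
Proof. by apply/eqP; move: a b c; apply: brute3; vm_compute. Qed.
Lemma zsubE a b : zsub a b = zadd a (zopp b).
Proof. by apply/eqP; move: a b; apply: brute2; vm_compute. Qed.
Lemma zmulN a b : zmul a (zopp b) = zopp (zmul a b).
Proof. by apply/eqP; move: a b; apply: brute2; vm_compute. Qed.
Lemma zaddK a b : zsub (zadd a b) b = a.
Proof. by apply/eqP; move: a b; apply: brute2; vm_compute. Qed.
Lemma zsubK a b : zadd (zsub a b) b = a.
Proof. by apply/eqP; move: a b; apply: brute2; vm_compute. Qed.
Lemma zaddNK a b : zadd (zopp a) (zadd a b) = b.
Proof. by apply/eqP; move: a b; apply: brute2; vm_compute. Qed.
Lemma zaddI a : injective (zadd a).
Proof. exact: can_inj (zaddNK a). Qed.
Lemma zoppK : involutive zopp. Proof. by case. Qed.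
Lemma zdbl_inj : injective zdbl. Proof. by apply: can_inj zhalf _; case. Qed.
Lemma zopp_inj : injective zopp. Proof. exact: inv_inj zoppK. Qed.

Lemma quo_lt z : quo z < 5. Proof. by case: z. Qed.
Lemma res_lt z : res z < 5. Proof. by case: z. Qed.
Lemma aget_amod A (g : A -> A) (m : arr A) z t :
  aget (amod g m z) t = if t == z then g (aget m t) else aget m t.
Proof.
case: m => -[? ? ? ? ?] [? ? ? ? ?] [? ? ? ? ?] [? ? ? ? ?] [? ? ? ? ?].
rewrite -zeqE; case: z; case: t; reflexivity.
Qed.
Lemma aget_amake A (f : z25 -> A) t : aget (amake f) t = f t.
Proof. by case: t. Qed.

Lemma mbitE z m : mbit z m = bit (quo z) (sel (res z) m).
Proof.
case: m => a b c d e.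
by case: z; first [by case: a | by case: b | by case: c | by case: d | by case: e].
Qed.
Definition dclear (q : nat) (d : dig) : dig := dmake (fun u => (u != q) && bit u d).
Lemma mclearE z m : mclear z m = upd (res z) (dclear (quo z)) m.
Proof.
case: m => a b c d e; case: z; congr P5;
  first [by case: a | by case: b | by case: c | by case: d | by case: e].
Qed.

Lemma sel_upd A i j (f : A -> A) m : i < 5 -> j < 5 ->
  sel i (upd j f m) = if i == j then f (sel i m) else sel i m.
Proof. by case: m => a b c d e; move: i j; do 5?[case=> [|]] => //; do 5?[case=> [|]]. Qed.
Lemma sel_mk5 A (g : nat -> A) i : i < 5 -> sel i (mk5 g) = g i.
Proof. by move: i; do 5?[case=> [|]]. Qed.

Lemma bit_dclear u q d : u < 5 -> q < 5 -> bit u (dclear q d) = (u != q) && bit u d.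
Proof.
move=> hu hq; apply/eqP.
have: all (fun d => all (fun u => all (fun q =>
  bit u (dclear q d) == (u != q) && bit u d) (iota 0 5)) (iota 0 5)) ds by vm_compute.
move=> /allP /(_ d (mem_ds d)) /allP /(_ u).
by rewrite mem_iota => /(_ hu) /allP /(_ q); rewrite mem_iota; apply.
Qed.

Lemma quo_res_eq a b : (a == b) = (quo a == quo b) && (res a == res b).
Proof. by rewrite -zeqE; apply/eqP; move: a b; apply: brute2; vm_compute. Qed.

Lemma mbit_mclear z t m : mbit t (mclear z m) = (t != z) && mbit t m.
Proof.
rewrite !mbitE mclearE sel_upd ?res_lt // quo_res_eq.
case: (res t == res z) => /=; last by rewrite andbF.
by rewrite bit_dclear ?quo_lt // andbT.
Qed.
Lemma mbit_full t : mbit t full. Proof. by case: t. Qed.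

Lemma bit_rland p u w d : p < 5 -> u < 5 ->
  bit u (rland p w d) = bit u w && bit ((u + p) %% 5) d.
Proof.
move=> hp hu; apply/eqP.
have: all (fun w => all (fun d => all (fun p => all (fun u =>
  bit u (rland p w d) == bit u w && bit ((u + p) %% 5) d) (iota 0 5)) (iota 0 5)) ds) ds.
  by vm_compute.
move=> /allP /(_ w (mem_ds w)) /allP /(_ d (mem_ds d)) /allP /(_ p).
by rewrite mem_iota => /(_ hp) /allP /(_ u); rewrite mem_iota; apply.
Qed.
Lemma bit_gate j u w d : u < 5 -> bit u (gate_ j w d) = bit j w && bit u d.
Proof.
have -> : gate_ j w d = if bit j w then d else d0 by case: w.
by case: ifP => //= _; move: u; do 5?[case=> [|]].
Qed.

Definition rot (k : z25) (w b e : mask) : mask :=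
  let r (h : z25) j (m : mask) wj :=
    rland ((quo h + (j + res h) %/ 5) %% 5) wj (sel ((j + res h) %% 5) m) in
  mk5 (fun j => r k j e (r (zopp k) j b (sel j w))).
(** Digit j collects the cells with x = a + 5 j, and its bit t is the one with y = b + 5 t. The
    rotations follow the quotients by 5 of y - x, with borrow 1 if b < a, and of x + y, with carry
    (a + b) / 5. *)
Definition box_mask (k : z25) (mx my md ms : mask) : mask :=
  let a := quo k in let b := res k in
  mk5 (fun j => gate_ j (sel a mx)
    (rland ((j + (a + b) %/ 5) %% 5)
      (rland ((10 - j - (b < a)) %% 5) (sel b my) (sel ((b + 5 - a) %% 5) md))
      (sel ((a + b) %% 5) ms))).
Lemma aliveE s v k : alive s v k =
  let: State mx my md ms me m2x m2y mn2x _ _ := s in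
  match v with
  | Row => rot k my md ms | Col => rot k mx me ms
  | Diag => rot k ms m2x m2y | Anti => rot k md mn2x m2y
  | Box => box_mask k mx my md ms
  end.
Proof.
case: s => - [? ? ? ? ?] [? ? ? ? ?] [? ? ? ? ?] [? ? ? ? ?] [? ? ? ? ?] [? ? ? ? ?].
move=> [? ? ? ? ?] [? ? ? ? ?] f nb.
by case: v; case: k; reflexivity.
Qed.

(** One formula serves four directions, because the other two attack values of the cell t of line k
    are always t - k and t + k: y - x and x + y on a row, x - y and x + y on a column, 2 x and 2 y
    on a diagonal, - 2 x and 2 y on an antidiagonal. This is why states keep masks for the doubled
    coordinates. *)
Lemma mbit_rot k w b e t :
  mbit t (rot k w b e) = [&& mbit t w, mbit (zsub t k) b & mbit (zadd t k) e].
Proof.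
have key h h' j : h' = zadd j h ->
    (quo j + (quo h + (res j + res h) %/ 5) %% 5) %% 5 = quo h' /\
    (res j + res h) %% 5 = res h'.
  move=> ->; suff /andP[/eqP ? /eqP ?] : ((quo j + (quo h + (res j + res h) %/ 5) %% 5) %% 5
    == quo (zadd j h)) && ((res j + res h) %% 5 == res (zadd j h)) by [].
  by move: h j; apply: brute2; vm_compute.
rewrite !mbitE /rot sel_mk5 ?res_lt // !bit_rland ?ltn_pmod ?quo_lt //.
have [-> ->] := key _ _ _ (zsubE t k); have [-> ->] := key k _ t erefl.
by rewrite andbA.
Qed.
Lemma mbit_box k mx my md ms t (x := boxx k t) (y := boxy k t) :
  mbit t (box_mask k mx my md ms) =
  [&& mbit x mx, mbit y my, mbit (zsub y x) md & mbit (zadd x y) ms].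
Proof.
rewrite !mbitE /box_mask sel_mk5 ?res_lt // bit_gate ?quo_lt //.
rewrite !bit_rland ?ltn_pmod ?quo_lt //.
suff: [&& quo x == res t, res x == quo k, quo y == quo t, res y == res k,
  (quo t + (10 - res t - (res k < quo k)) %% 5) %% 5 == quo (zsub y x),
  (res k + 5 - quo k) %% 5 == res (zsub y x),
  (quo t + (res t + (quo k + res k) %/ 5) %% 5) %% 5 == quo (zadd x y) &
  (quo k + res k) %% 5 == res (zadd x y)].
  by case/and5P=> /eqP-> /eqP-> /eqP-> /eqP-> /and4P[/eqP-> /eqP-> /eqP-> /eqP->]; rewrite !andbA.
by rewrite {}/x {}/y; move: k t; apply: brute2; vm_compute.
Qed.

Lemma digz_cat :
  (forall d l, digz0 d l = digz0 d [::] ++ l) * (forall d l, digz1 d l = digz1 d [::] ++ l) *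
  (forall d l, digz2 d l = digz2 d [::] ++ l) * (forall d l, digz3 d l = digz3 d [::] ++ l) *
  (forall d l, digz4 d l = digz4 d [::] ++ l).
Proof. by do !split; case. Qed.
Lemma mem_elements t m : (t \in elements m) = mbit t m.
Proof.
case: m => a b c d e; rewrite mbitE /elements.
rewrite [digz0 a _]digz_cat [digz1 b _]digz_cat [digz2 c _]digz_cat [digz3 d _]digz_cat.
rewrite !mem_cat.
have h (i : nat) (g : dig -> seq z25 -> seq z25) :
    all (fun x => all (fun t => (t \in g x [::]) == ((res t == i) && bit (quo t) x)) zs) ds ->
    forall x, (t \in g x [::]) = (res t == i) && bit (quo t) x.
  by move=> /allP h x; apply/eqP; move/allP: (h x (mem_ds x)); apply; apply: mem_zs.
rewrite (h 0 digz0); last by vm_compute.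
rewrite (h 1 digz1); last by vm_compute.
rewrite (h 2 digz2); last by vm_compute.
rewrite (h 3 digz3); last by vm_compute.
rewrite (h 4 digz4); last by vm_compute.
by have := res_lt t; case: (res t) => [|[|[|[|[|]]]]] // _; rewrite /= ?orbF.
Qed.

(** * Transfer to the ring ['Z_25], units and residues modulo 5 *)

Definition zr (z : z25) : 'Z_25 := inZp (ton z).
Lemma zr_inj : injective zr.
Proof. by apply: (can_inj (g := fun i => ofn (val i))); case. Qed.
Lemma zrD a b : zr (zadd a b) = (zr a + zr b)%R.
Proof. by apply/eqP; move: a b; apply: brute2; vm_compute. Qed.
Lemma zrM a b : zr (zmul a b) = (zr a * zr b)%R.
Proof. by apply/eqP; move: a b; apply: brute2; vm_compute. Qed.
Lemma zrB a b : zr (zsub a b) = (zr a - zr b)%R.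
Proof. by apply/eqP; move: a b; apply: brute2; vm_compute. Qed.
Lemma zrN a : zr (zopp a) = (- zr a)%R.
Proof. by apply/eqP; move: a; apply: brute1; vm_compute. Qed.
Definition zrE := (zrD, zrM, zrB, zrN).
Ltac zring := apply: zr_inj; rewrite ?zrE; ring.

Definition zinv (u : z25) : z25 := nth z0 zs (find (fun v => zeq (zmul u v) z1) zs).
Lemma zmulVK u a : zunit u -> zmul (zinv u) (zmul u a) = a.
Proof. by move=> hu; apply/eqP; move: hu; apply/implyP; move: u a; apply: brute2; vm_compute. Qed.
Lemma zmulKV u a : zunit u -> zmul u (zmul (zinv u) a) = a.
Proof. by move=> hu; apply/eqP; move: hu; apply/implyP; move: u a; apply: brute2; vm_compute. Qed.
Lemma zaffK u t a b : zunit u -> zadd (zmul u a) t = zadd (zmul u b) t -> a = b.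
Proof.
move=> hu /(congr1 (fun z => zmul (zinv u) (zsub z t))).
by rewrite !zaddK !zmulVK.
Qed.

Lemma res_ofn n : res (ofn n) = n %% 5.
Proof.
rewrite /ofn /res.
have /eqP -> : ton (nth z0 zs (n %% 25)) == n %% 25.
  have: all (fun m => ton (nth z0 zs m) == m) (iota 0 25) by vm_compute.
  by move/allP; apply; rewrite mem_iota ltn_pmod.
by rewrite modn_dvdm.
Qed.
Lemma res_zadd a b : res (zadd a b) = (res a + res b) %% 5.
Proof. by apply/eqP; move: a b; apply: brute2; vm_compute. Qed.
Lemma res_zmul a b : res (zmul a b) = (res a * res b) %% 5.
Proof. by apply/eqP; move: a b; apply: brute2; vm_compute. Qed.
Lemma zunitE u : zunit u = (res u != 0). Proof. by case: u. Qed.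
Lemma zbox_eqE a b k : (zbox a b == k) = (res a == quo k) && (res b == res k).
Proof. by rewrite -zeqE; apply/eqP; move: a b k; apply: brute3; vm_compute. Qed.
Lemma quo_zbox a b : quo (zbox a b) = res a.
Proof. by apply/eqP; move: a b; apply: brute2; vm_compute. Qed.
Lemma res_zbox a b : res (zbox a b) = res b.
Proof. by apply/eqP; move: a b; apply: brute2; vm_compute. Qed.

Lemma perm_zs (g : z25 -> z25) : injective g -> perm_eq (map g zs) zs.
Proof.
move=> gI; apply: uniq_perm; rewrite ?map_inj_uniq ?uniq_zs // => z.
have [||_ -> //] := @uniq_min_size _ (map g zs) zs _ (fun z _ => mem_zs z).
  by rewrite map_inj_uniq ?uniq_zs.
by rewrite size_map.
Qed.
Lemma zs_surj (g : z25 -> z25) k : injective g -> exists x, g x = k.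
Proof.
move=> gI; have := mem_zs k; rewrite -(perm_mem (perm_zs gI)).
by case/mapP=> x _ ->; exists x.
Qed.
Lemma count_zs (g : z25 -> z25) (P : pred z25) :
  injective g -> count (fun x => P (g x)) zs = count P zs.
Proof. by move=> gI; rewrite -(seq.permP (perm_zs gI) P) count_map. Qed.

Record good (p : z25 -> z25) : Prop := Good {
  good_inj : injective p;
  good_diff : injective (fun x => zsub (p x) x);
  good_sum : injective (fun x => zadd x (p x));
  good_cycle : forall i x m, 0 < m <= 7 ->
    iter m (fun z => zsub (p z) i) x = x -> zsub (p x) i = x }.

Definition boxcount (p : z25 -> z25) (k : z25) : nat :=
  count (fun x => zbox x (p x) == k) zs.
Definition fits (cap : caps) (p : z25 -> z25) : Prop :=
  forall k, boxcount p k = aget cap k.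
Definition contains (p : z25 -> z25) (sh : shape) : bool :=
  all (fun c => p c.1 == c.2) sh.
Definition refuted (cap : caps) (sh : shape) : Prop :=
  forall p, good p -> fits cap p -> contains p sh -> False.

Section Affine.
Variables (p q : z25 -> z25) (u tx ty : z25).
Hypothesis hu : zunit u.
Hypothesis pq : forall x, p (zadd (zmul u x) tx) = zadd (zmul u (q x)) ty.

(** The map x -> u x + tx conjugates z -> q(z) - i to z -> p(z) - i' with i' = u i + ty - tx, while
    differences and sums are scaled by the unit u and translated. *)
Lemma good_affine : good p -> good q.
Proof.
case=> pI pD pS pC; split.
- by move=> x y e; apply: (zaffK (t := tx) hu); apply: pI; rewrite !pq e.
- move=> x y /= e; apply: (zaffK (t := tx) hu); apply: pD => /=; rewrite !pq.
  have h a b : zsub (zadd (zmul u a) ty) (zadd (zmul u b) tx) =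
    zadd (zmul u (zsub a b)) (zsub ty tx) by zring.
  by rewrite !h e.
- move=> x y /= e; apply: (zaffK (t := tx) hu); apply: pS => /=; rewrite !pq.
  have h a b : zadd (zadd (zmul u a) tx) (zadd (zmul u b) ty) =
    zadd (zmul u (zadd a b)) (zadd tx ty) by zring.
  by rewrite !h e.
move=> i x m hm.
pose i' := zsub (zadd (zmul u i) ty) tx; pose phi x := zadd (zmul u x) tx.
have h z : zsub (p (phi z)) i' = phi (zsub (q z) i).
  by rewrite pq /i' /phi; zring.
have hi n z : iter n (fun z => zsub (p z) i') (phi z) =
    phi (iter n (fun z => zsub (q z) i) z).
  by elim: n => //= n ->.
move=> e; apply: (zaffK (t := tx) hu); rewrite -[LHS]/(phi _) -h.
by apply: (pC _ _ m) => //; rewrite hi e.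
Qed.

Lemma boxcount_affine k :
  boxcount q k = boxcount p (move_box (res u) (res tx) (res ty) false k).
Proof.
have phiI : injective (fun x => zadd (zmul u x) tx) by move=> x y; apply: zaffK.
rewrite /boxcount -[RHS](count_zs (fun x => zbox x (p x) == _) phiI).
apply: eq_count => x /=; rewrite pq /move_box !zbox_eqE quo_zbox res_zbox.
rewrite !res_ofn !res_zadd !res_zmul.
have h a b t : a < 5 -> b < 5 -> t < 5 ->
    (((res u * a) %% 5 + t) %% 5 == (res u * b + t) %% 5) = (a == b).
  move=> ha hb ht; rewrite modnDml eqn_modDr; move: hu (res_lt u); rewrite zunitE.
  case: (res u) => [|[|[|[|[|?]]]]] //; case: a ha => [|[|[|[|[|?]]]]] //;
    by case: b hb => [|[|[|[|[|?]]]]].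
by rewrite !h ?res_lt ?quo_lt.
Qed.
End Affine.

Section Inverse.
Variables (p r : z25 -> z25).
Hypotheses (pK : cancel p r) (rK : cancel r p).

(** The inverse of z -> r(z) - i is z -> p(z + i), which translation by i conjugates to z -> p(z) +
    i; so cycle lengths are the same on both sides. Transposing the board keeps sums and negates
    differences. *)
Lemma good_inverse : good p -> good r.
Proof.
case=> pI pD pS pC; split; first exact: can_inj rK.
- move=> x y /= e; apply: (can_inj rK); apply: pD; rewrite /= !rK.
  have h a b : zopp (zsub a b) = zsub b a by zring.
  by apply: zopp_inj; rewrite !h.
- by move=> x y /= e; apply: (can_inj rK); apply: pS; rewrite /= !rK ![zadd (r _) _]zaddC.
move=> i x m hm; pose g z := zsub (r z) i; pose h z := p (zadd z i).
have gh : cancel g h by move=> z; rewrite /g /h zsubK rK.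
move=> e.
have hg n z : iter n h (iter n g z) = z.
  by elim: n z => // n IH z; rewrite iterSr [iter n.+1 g z]iterS gh IH.
have e' : iter m h x = x by have := hg m x; rewrite [iter m g x]e.
have s n z : iter n (fun z => zsub (p z) (zopp i)) (zadd z i) = zadd (iter n h z) i.
  by elim: n => //= n ->; rewrite /h; zring.
have := pC (zopp i) (zadd x i) m hm; rewrite s e' => /(_ erefl) e2.
have hx : h x = x.
  have: zadd (h x) i = zadd x i by rewrite -[RHS]e2 /h; zring.
  by move/(congr1 (zsub ^~ i)); rewrite !zaddK.
by rewrite -[in LHS]hx -/(g _) /g /h pK zaddK.
Qed.
Lemma boxcount_inverse k :
  boxcount r k = boxcount p (zbox (ofn (res k)) (ofn (quo k))).
Proof.
rewrite /boxcount -(count_zs (fun x => zbox x (r x) == k) (can_inj pK)).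
apply: eq_count => x /=; rewrite pK !zbox_eqE quo_zbox res_zbox !res_ofn.
by rewrite !modn_small ?res_lt ?quo_lt // andbC.
Qed.
End Inverse.

(** The graph of q is the preimage of the graph of p under the symmetry, so a shape lies in q
    exactly when its image lies in p. The transposed case passes to the inverse permutation. *)
Lemma symmetric_copy p u tx ty sw : zunit u -> good p ->
  exists q, [/\ good q,
    forall k, boxcount q k = boxcount p (move_box (res u) (res tx) (res ty) sw k) &
    forall c, (q c.1 == c.2) = (p (movex u tx sw c) == movey u ty sw c)].
Proof.
move=> hu gp.
pose q x := zmul (zinv u) (zsub (p (zadd (zmul u x) tx)) ty).
have pq x : p (zadd (zmul u x) tx) = zadd (zmul u (q x)) ty by rewrite /q zmulKV // zsubK.
have gq := good_affine hu pq gp.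
case: sw; last first.
  exists q; split=> // [k|c]; first exact: boxcount_affine pq _.
  rewrite /movex /movey /= pq; apply/eqP/eqP => [->//|]; exact: zaffK.
have qI := good_inj gq.
exists (invF qI); split=> [|k|c].
- exact: good_inverse (invF_f qI) (f_invF qI) gq.
- rewrite (boxcount_inverse (invF_f qI)) (boxcount_affine hu pq); congr boxcount.
  by rewrite /move_box quo_zbox res_zbox !res_ofn !modn_small ?res_lt ?quo_lt.
rewrite /movex /movey /= pq (inj_eq (f := fun z => zadd (zmul u z) ty)).
  by rewrite (can2_eq (f_invF qI) (invF_f qI)) eq_sym.
move=> x y; exact: zaffK.
Qed.

Arguments alive : simpl never.
Arguments elements : simpl never.
Lemma rselE A z (m : p5 A) : rsel z m = sel (res z) m.
Proof. by case: m => a b c d e; case: z. Qed.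
Lemma sym_okE cap u tx ty sw :
  sym_ok (symmetries cap) u tx ty sw = preserves cap (res u) (res tx) (res ty) sw.
Proof. by rewrite /sym_ok !rselE /symmetries !sel_mk5 ?res_lt //; case: sw. Qed.

(** * Soundness of the checker *)

Definition misses (m : mask) (g : z25 -> z25) (D : seq z25) : Prop :=
  forall t, mbit t m = (t \notin map g D).
Lemma misses_cons m g D x : misses m g D -> misses (mclear (g x) m) g (x :: D).
Proof. by move=> h t; rewrite mbit_mclear h inE negb_or. Qed.
Lemma misses_nil g : misses full g [::].
Proof. exact: mbit_full. Qed.
Lemma misses_mem m g D x : injective g -> misses m g D -> x \notin D -> mbit (g x) m.
Proof. by move=> gI ->; rewrite mem_map. Qed.

(** Serves for the cells that p does not occupy: of their sub-refutations it only matters that the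
    stream goes on afterwards. *)
Lemma check_next st forb n s v k l next :
  check st forb n s v k l next -> exists l', next l'.
Proof.
elim: n s v k l next => //= n IH s v k l next; case: (open_line s v k) => //.
elim: (elements (alive s v k)) l => [|t ts IHt] l; first by exists l.
case: l => // b l; case: (decode b) => [v' k'|i|i|i|i|i||sw].
- by case/IH=> l' /IHt.
- by case: (follow2 _ _ _ _) => // /IHt.
- by case: (follow3 _ _ _ _) => // /IHt.
- by case: (follow4 _ _ _ _) => // /IHt.
- by case: (follow5 _ _ _ _) => // /IHt.
- by case: (follow6 _ _ _ _) => // /IHt.
- by case: (aget _ _) => // /IHt.
case: l => [//|u [//|tx [//|ty [//|j l]]]].
case: (nth _ _ _) => // c sh; case: (sym_ok _ _ _ _ _) => //.
by case: (occupied_all _ _ _ _ _ _ _ _) => // /IHt.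
Qed.

Section Soundness.
Variables (cap : caps) (forbidden : seq shape) (p : z25 -> z25).
Hypotheses (gp : good p) (fp : fits cap p).
Hypothesis nogoods : forall sh, sh \in forbidden -> refuted cap sh.

Definition used (k : z25) (D : seq z25) : nat := count (fun x => zbox x (p x) == k) D.
(* [s] is the restriction of [p] to [D] *)
Definition records (s : state) (D : seq z25) : Prop :=
  let: State mx my md ms me m2x m2y mn2x f nb := s in
  [/\ misses mx id D /\ misses my p D,
      misses md (fun x => zsub (p x) x) D /\ misses ms (fun x => zadd x (p x)) D,
      misses me (fun x => zsub x (p x)) D /\ misses m2x zdbl D,
      misses m2y (fun x => zdbl (p x)) D /\ misses mn2x (fun x => zopp (zdbl x)) D &
      [/\ uniq D, forall x, aget f x = (if x \in D then Some (p x) else None) &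
          forall k, aget nb k + used k D = aget cap k]].

Lemma used_le k D : uniq D -> used k D <= aget cap k.
Proof.
move=> uD; rewrite -fp /used /boxcount -!size_filter; apply: uniq_leq_size.
  exact: filter_uniq.
by move=> x; rewrite !mem_filter mem_zs andbT; case/andP.
Qed.

Lemma records_place s D x : x \notin D -> records s D -> records (place s x (p x)) (x :: D).
Proof.
case: s => mx my md ms me m2x m2y mn2x f nb xD [[h1 h2] [h3 h4] [h5 h6] [h7 h8] [uD hf hn]].
have uxD : uniq (x :: D) by rewrite /= xD.
split; do ?split=> //.
- exact: misses_cons.
- exact: misses_cons.
- exact: (@misses_cons _ (fun x => zsub (p x) x)).
- exact: (@misses_cons _ (fun x => zadd x (p x))).
- exact: (@misses_cons _ (fun x => zsub x (p x))).
- exact: misses_cons.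
- exact: (@misses_cons _ (fun x => zdbl (p x))).
- exact: (@misses_cons _ (fun x => zopp (zdbl x))).
- by move=> z; rewrite aget_amod inE hf; case: eqP => [->|].
(* [predn] does not truncate: by [used_le] for x :: D, the box of the new queen still has room. *)
move=> k; rewrite aget_amod; have := used_le k uxD; rewrite -(hn k) /=.
by rewrite [k == _]eq_sym; case: (_ == k) => /=; lia.
Qed.

Lemma records0 : records (state0 cap) [::].
Proof.
split; do ?split=> //; try exact: misses_nil.
  by move=> x; rewrite aget_amake.
by move=> k; rewrite addn0.
Qed.

(** Each of the four linear forms is a bijection along p, so every row, column, diagonal and
    antidiagonal has its queen; for a box, counting finds one. This queen is unattacked because the
    forms stay injective after negation and doubling. *)
Lemma line_cell s D v k : records s D -> open_line s v k ->
  exists t, [/\ t \in elements (alive s v k), cellx v k t \notin D &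
                p (cellx v k t) = celly v k t].
Proof.
have [pI pD pS _] := gp.
have pE : injective (fun x => zsub x (p x)).
  move=> x y /= /(congr1 zopp); have h a b : zopp (zsub a b) = zsub b a by zring.
  by rewrite !h; apply: pD.
case: s => mx my md ms me m2x m2y mn2x f nb [[h1 h2] [h3 h4] [h5 h6] [h7 h8] [uD hf hn]].
have free x : x \notin D -> [/\ mbit x mx /\ mbit (p x) my,
    mbit (zsub (p x) x) md /\ mbit (zadd x (p x)) ms, mbit (zsub x (p x)) me /\ mbit (zdbl x) m2x &
    mbit (zdbl (p x)) m2y /\ mbit (zopp (zdbl x)) mn2x].
  move=> xD; do !split.
  - exact: (misses_mem (g := id)) h1 xD.
  - exact: misses_mem h2 xD.
  - exact: (misses_mem pD h3 xD).
  - exact: (misses_mem pS h4 xD).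
  - exact: (misses_mem pE h5 xD).
  - exact: (misses_mem zdbl_inj h6 xD).
  - by apply: (misses_mem (g := fun x => zdbl (p x)) _ h7 xD) => a b /zdbl_inj /pI.
  by apply: (misses_mem (g := fun x => zopp (zdbl x)) _ h8 xD) => a b /zopp_inj /zdbl_inj.
have dE a : zdbl a = zadd a a by apply/eqP; move: a; apply: brute1; vm_compute.
have halfD a b : halfsub (zadd a b) (zsub b a) = a /\ halfadd (zadd a b) (zsub b a) = b.
  suff /andP[/eqP-> /eqP->] : (halfsub (zadd a b) (zsub b a) == a) &&
    (halfadd (zadd a b) (zsub b a) == b) by [].
  by move: a b; apply: brute2; vm_compute.
have halfA a b : halfsub (zadd a b) (zsub b a) = a /\ halfadd (zsub b a) (zadd a b) = b.
  suff /andP[/eqP-> /eqP->] : (halfsub (zadd a b) (zsub b a) == a) &&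
    (halfadd (zsub b a) (zadd a b) == b) by [].
  by move: a b; apply: brute2; vm_compute.
case: v => /= hk.
- exists (p k); have kD : k \notin D by rewrite h1 map_id in hk.
  have [[a1 a2] [a3 a4] _ _] := free _ kD.
  split=> //; rewrite mem_elements aliveE mbit_rot a2 a3 /=.
  by rewrite zaddC.
- have [x ex] := zs_surj k pI; exists x; rewrite h2 -ex mem_map // in hk.
  have [[a1 a2] [a3 a4] [a5 a6] _] := free _ hk.
  by split=> //; rewrite mem_elements aliveE mbit_rot -ex a1 a5.
- have [x ex] := zs_surj k pD; rewrite h3 -ex (mem_map pD) in hk.
  exists (zadd x (p x)); have [[a1 a2] [a3 a4] [a5 a6] [a7 a8]] := free _ hk.
  rewrite -ex; have [-> ->] := halfD x (p x); split=> //.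
  rewrite mem_elements aliveE mbit_rot a4 /=.
  have -> : zsub (zadd x (p x)) (zsub (p x) x) = zdbl x by rewrite dE; zring.
  have -> : zadd (zadd x (p x)) (zsub (p x) x) = zdbl (p x) by rewrite dE; zring.
  by rewrite a6 a7.
- have [x ex] := zs_surj k pS; rewrite h4 -ex (mem_map pS) in hk.
  exists (zsub (p x) x); have [[a1 a2] [a3 a4] [a5 a6] [a7 a8]] := free _ hk.
  rewrite -ex; have [-> ->] := halfA x (p x); split=> //.
  rewrite mem_elements aliveE mbit_rot a3 /=.
  have -> : zsub (zsub (p x) x) (zadd x (p x)) = zopp (zdbl x) by rewrite dE; zring.
  have -> : zadd (zsub (p x) x) (zadd x (p x)) = zdbl (p x) by rewrite dE; zring.
  by rewrite a8 a7.
(* If all queens of the box had their rows in D, the box count would be at most [used k D], and no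
   queen would be missing. *)
have /hasP[x _ /andP[/eqP ex xD]] : has (fun x => (zbox x (p x) == k) && (x \notin D)) zs.
  apply/negPn/negP; rewrite -all_predC => /allP hall.
  have: boxcount p k <= used k D.
    rewrite /boxcount /used -!size_filter; apply: uniq_leq_size.
      exact: filter_uniq uniq_zs.
    move=> x; rewrite !mem_filter => /andP[e _]; rewrite e /=.
    by have := hall x (mem_zs x); rewrite /= e /= negbK.
  by rewrite fp -(hn k); case: (aget nb k) hk => //= n _; lia.
have [[a1 a2] [a3 a4] _ _] := free _ xD.
have [t [ext eyt]] : exists t, boxx k t = x /\ boxy k t = p x.
  exists (ofn (quo x + 5 * quo (p x))).
  suff /andP[/eqP ? /eqP ?] : (boxx k (ofn (quo x + 5 * quo (p x))) == x) &&
      (boxy k (ofn (quo x + 5 * quo (p x))) == p x) by [].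
  by rewrite -ex; move: x (p x) {ex xD a1 a2 a3 a4}; apply: brute2; vm_compute.
by exists t; rewrite ext eyt; split=> //; rewrite mem_elements aliveE mbit_box ext eyt a1 a2 a3 a4.
Qed.

Lemma follow_sound s D n i x a : records s D -> follow n (partial s) i x a ->
  iter n (fun z => zsub (p z) i) a = x /\ (0 < n -> a \in D).
Proof.
case: s => mx my md ms me m2x m2y mn2x f nb [_ _ _ _ [_ hf _]] /=.
elim: n a => [|n IH] a /=; first by rewrite zeqE => /eqP.
rewrite hf; case: ifP => // aD /IH[e _]; split=> //.
by rewrite -e; exact: (iterSr n (fun z => zsub (p z) i) a).
Qed.
(** Goodness forces p(x) - i = x; but the walk starts at p(x) - i, which lies in D, and x does
    not. *)
Lemma cycle_sound s D n i x : records s D -> x \notin D -> 0 < n <= 6 ->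
  follow n (partial s) i x (zsub (p x) i) -> False.
Proof.
move=> hs xD /andP[n0 n6] /(follow_sound hs)[e /(_ n0) aD].
have := good_cycle gp (i := i) (x := x) (m := n.+1).
rewrite iterSr e => h; case/negP: xD; rewrite -[x]h //; lia.
Qed.
Lemma forbidden_sound s D x u tx ty sw sh : records s D -> sh \in forbidden ->
  preserves cap (res u) (res tx) (res ty) sw ->
  occupied_all (partial s) x (p x) u tx ty sw sh -> False.
Proof.
move=> hs hsh /andP[hu /allP hcap] hocc.
have [q [gq bq cq]] := symmetric_copy tx ty sw (etrans (zunitE u) hu) gp.
apply: (nogoods hsh gq) => [k|].
  by rewrite bq fp; apply/eqP/hcap/mem_zs.
rewrite /contains; elim: sh hocc {hsh} => //= c sh IH.
case ho: (occupied _ _ _ _ _) => // /IH->; rewrite andbT cq.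
move: ho; rewrite /occupied zeqE; case: eqP => [->|_]; first by rewrite zeqE eq_sym.
case: s hs {IH} => mx my md ms me m2x m2y mn2x f nb [_ _ _ _ [_ hf _]] /=.
by rewrite hf; case: ifP => // _; rewrite zeqE.
Qed.

(** Only the cell of p on the current line matters. By [line_cell] it is among the cells listed; a
    branch there enlarges D by one queen of p, and any other action contradicts p. *)
Lemma check_sound n s D v k l next : records s D ->
  check (symmetries cap) forbidden n s v k l next -> False.
Proof.
elim: n s D v k l next => //= n IH s D v k l next hs.
case ho: (open_line s v k) => //.
have [t [ht xD ey]] := line_cell hs ho.
elim: (elements _) ht l => // t' ts IHt; rewrite inE => /orP ht [//|b l].
have [tt|nt] := eqVneq t t'; last first.
  have {}ht : t \in ts by case: ht => // /eqP e; rewrite e eqxx in nt.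
  move: IHt => /(_ ht) {}IHt; case: (decode b) => [v' k'|i|i|i|i|i||sw].
  - by case/check_next=> l' /IHt.
  - by case: (follow2 _ _ _ _) => // /IHt.
  - by case: (follow3 _ _ _ _) => // /IHt.
  - by case: (follow4 _ _ _ _) => // /IHt.
  - by case: (follow5 _ _ _ _) => // /IHt.
  - by case: (follow6 _ _ _ _) => // /IHt.
  - by case: (aget _ _) => // /IHt.
  case: l => [//|u [//|tx [//|ty [//|j l]]]].
  case: (nth _ _ _) => // c sh; case: (sym_ok _ _ _ _ _) => //.
  by case: (occupied_all _ _ _ _ _ _ _ _) => // /IHt.
rewrite -tt -ey; move: (cellx v k t) xD => x xD {IHt ht tt ey t}.
case: (decode b) => [v' k'|i|i|i|i|i||sw].
- by apply: IH; apply: records_place xD hs.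
- by case hf: (follow2 _ _ _ _) => // _; apply: (@cycle_sound s D 2 i x).
- by case hf: (follow3 _ _ _ _) => // _; apply: (@cycle_sound s D 3 i x).
- by case hf: (follow4 _ _ _ _) => // _; apply: (@cycle_sound s D 4 i x).
- by case hf: (follow5 _ _ _ _) => // _; apply: (@cycle_sound s D 5 i x).
- by case hf: (follow6 _ _ _ _) => // _; apply: (@cycle_sound s D 6 i x).
- case hn: (aget _ _) => // _.
  have := records_place xD hs; case: (s) hs hn => mx my md ms me m2x m2y mn2x f nb.
  move=> [_ _ _ _ [uD _ h]] /= hn _.
  have /(used_le (zbox x (p x))) : uniq (x :: D) by rewrite /= xD.
  by rewrite -h hn /= eqxx; lia.
case: l => [//|u [//|tx [//|ty [//|j l]]]].
case hsh: (nth _ _ _) => [//|c sh]; rewrite sym_okE.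
case hp: (preserves _ _ _ _ _) => //.
case hocc: (occupied_all _ _ _ _ _ _ _ _) => // _.
apply: (forbidden_sound hs _ hp hocc); rewrite -hsh mem_nth // ltnNge.
by apply/negP => h; rewrite nth_default in hsh.
Qed.
End Soundness.

Lemma records_shape cap p sh : good p -> fits cap p -> contains p sh ->
  uniq [seq ton d.1 | d <- sh] -> records cap p (state_of cap sh) [seq d.1 | d <- sh].
Proof.
move=> gp fp; elim: sh => [|[x y] sh IH] /=; first by move=> _ _; apply: records0.
case/andP=> /eqP <- hc /andP[xD uD]; apply: records_place => //; last exact: IH.
by apply: contra xD => /(map_f ton); rewrite -map_comp.
Qed.

Lemma refutes_sound n cap forbidden sh r :
  (forall sh, sh \in forbidden -> refuted cap sh) ->
  refutes n cap forbidden sh r -> refuted cap sh.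
Proof.
move=> hf /andP[hu]; case: (flat r [::]) => // b l; case: (decode b) => // v k hc p gp fp hp.
exact: check_sound gp fp hf _ _ _ _ _ _ _ (records_shape gp fp hp hu) hc.
Qed.

(** * Box counts and their classification *)

Lemma sum_boxes (h : z25 -> z25) (P : pred z25) s :
  count (fun x => P (h x)) s = \sum_(k <- zs | P k) count (fun x => h x == k) s.
Proof.
elim: s => [|x s IH] /=; first by rewrite big1.
rewrite big_split /= -IH; congr (_ + _).
rewrite big_mkcond (bigD1_seq (h x)) ?mem_zs ?uniq_zs //= eqxx big1 => [|k hk].
  by case: (P _).
by rewrite eq_sym (negPf hk); case: ifP.
Qed.

(** The residue of g x can be read off the box, and a bijection of Z/25 takes each residue modulo 5
    five times. *)
Lemma class_sum p g (cls : z25 -> nat) r : injective g -> r < 5 ->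
  (forall x, cls (zbox x (p x)) = res (g x)) ->
  \sum_(k <- zs | cls k == r) boxcount p k = 5.
Proof.
move=> gI hr hc; rewrite -(sum_boxes (fun x => zbox x (p x)) (fun k => cls k == r)).
rewrite (eq_count (a2 := fun x => res (g x) == r)) => [|x]; last by rewrite /= hc.
rewrite (count_zs (fun z => res z == r) gI).
by case: r hr => [|[|[|[|[|]]]]].
Qed.

Definition infeasible (cap : caps) : Prop := forall p, good p -> fits cap p -> False.

(** Translations by multiples of 5 fix every box, so any queen in the box of (ox, oy) can be carried
    to (ox, oy) itself. *)
Lemma infeasible_corner cap ox oy :
  0 < aget cap (zbox ox oy) -> refuted cap [:: (ox, oy)] -> infeasible cap.
Proof.
move=> h0 href p gp fp; move: h0; rewrite -fp -has_count => /hasP[x _].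
rewrite zbox_eqE quo_zbox res_zbox => /andP[/eqP e1 /eqP e2].
have [q [gq bq cq]] := symmetric_copy (zsub x ox) (zsub (p x) oy) false (erefl : zunit z1) gp.
have hz a b : res a = res b -> res (zsub a b) = 0.
  move/eqP=> h; apply/eqP; move: h; apply/implyP; move: a b; apply: brute2; vm_compute; done.
apply: (href q gq) => [k|].
  rewrite bq fp !hz //; congr aget.
  by apply/eqP; move: k; apply: brute1; vm_compute.
rewrite /contains /= andbT (cq (ox, oy)) /movex /movey /=.
have h a b : zadd (zmul z1 a) (zsub b a) = b.
  by apply/eqP; move: a b; apply: brute2; vm_compute.
by rewrite !h.
Qed.

Definition caps_of (l : seq nat) : caps := amake (fun z => nth 0 l (ton z)).

(** The matrices row by row: all ones, then 22 representatives with a zero at the origin. *)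
Definition box_types : seq (seq nat) := [::
  [:: 1;1;1;1;1; 1;1;1;1;1; 1;1;1;1;1; 1;1;1;1;1; 1;1;1;1;1];
  [:: 0;1;1;1;2; 1;1;1;1;1; 2;1;1;1;0; 1;0;1;2;1; 1;2;1;0;1];
  [:: 0;1;1;1;2; 1;1;2;0;1; 2;0;1;1;1; 1;1;1;2;0; 1;2;0;1;1];
  [:: 0;0;1;2;2; 1;2;1;0;1; 1;1;1;1;1; 1;0;1;2;1; 2;2;1;0;0];
  [:: 0;0;2;1;2; 1;2;1;0;1; 1;1;0;2;1; 1;1;1;2;0; 2;1;1;0;1];
  [:: 0;0;1;2;2; 1;3;1;0;0; 1;0;0;2;2; 1;1;2;1;0; 2;1;1;0;1];
  [:: 0;0;1;1;3; 1;2;1;0;1; 1;1;1;2;0; 2;0;0;2;1; 1;2;2;0;0];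
  [:: 0;0;1;1;3; 1;1;2;0;1; 2;1;1;1;0; 1;0;0;3;1; 1;3;1;0;0];
  [:: 0;0;2;1;2; 1;2;0;0;2; 0;2;1;2;0; 2;0;0;2;1; 2;1;2;0;0];
  [:: 0;0;1;2;2; 1;2;2;0;0; 2;0;0;1;2; 0;1;2;2;0; 2;2;0;0;1];
  [:: 0;0;0;2;3; 1;2;2;0;0; 2;0;1;1;1; 1;0;1;2;1; 1;3;1;0;0];
  [:: 0;0;1;1;3; 0;2;2;0;1; 2;1;0;1;1; 1;0;1;3;0; 2;2;1;0;0];
  [:: 0;0;1;3;1; 1;3;1;0;0; 1;0;0;1;3; 0;1;3;1;0; 3;1;0;0;1];
  [:: 0;0;1;1;3; 1;1;3;0;0; 3;0;0;1;1; 0;1;1;3;0; 1;3;0;0;1];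
  [:: 0;0;0;2;3; 0;3;2;0;0; 2;0;0;1;2; 1;0;2;2;0; 2;2;1;0;0];
  [:: 0;0;0;2;3; 0;2;3;0;0; 3;0;0;0;2; 0;0;2;3;0; 2;3;0;0;0];
  [:: 0;0;0;1;4; 0;1;4;0;0; 4;0;0;0;1; 0;0;1;4;0; 1;4;0;0;0];
  [:: 0;0;0;1;4; 0;4;1;0;0; 1;0;0;3;1; 3;0;1;1;0; 1;1;3;0;0];
  [:: 0;0;0;1;4; 0;3;2;0;0; 2;0;0;2;1; 2;0;1;2;0; 1;2;2;0;0];
  [:: 0;0;0;1;4; 0;2;3;0;0; 3;0;0;1;1; 1;0;1;3;0; 1;3;1;0;0];
  [:: 0;0;0;0;5; 0;2;3;0;0; 3;0;0;2;0; 2;0;0;3;0; 0;3;2;0;0];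
  [:: 0;0;0;0;5; 0;1;4;0;0; 4;0;0;1;0; 1;0;0;4;0; 0;4;1;0;0];
  [:: 0;0;0;0;5; 0;0;5;0;0; 5;0;0;0;0; 0;0;0;5;0; 0;5;0;0;0]].

(** Parts may be zero; there are 792 for n = 8 and m = 5. *)
Fixpoint compositions (n m : nat) : seq (seq nat) :=
  if n is n'.+1 then
    flatten [seq [seq a :: s | s <- compositions n' (m - a)] | a <- iota 0 m.+1]
  else if m == 0 then [:: [::]] else [::].
Lemma mem_compositions s : s \in compositions (size s) (sumn s).
Proof.
elim: s => // a s IH; rewrite -[sumn (a :: s)]/(a + sumn s).
rewrite -[compositions _ _]/(flatten [seq [seq b :: r | r <- compositions (size s) (a + sumn s - b)]
  | b <- iota 0 (a + sumn s).+1]).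
apply/flatten_mapP; exists a; first by rewrite mem_iota; lia.
by apply/mapP; exists s => //; rewrite addKn.
Qed.

(* The only solutions of the 20 linear equations with a vanishing first entry are
   sums of a function of [b - 2 a] and a function of [b + 2 a]. *)
Definition box_vector (s : seq nat) : seq nat :=
  [seq nth 0 (0 :: take 4 s) ((res k + 10 - 2 * quo k) %% 5) +
       nth 0 (0 :: drop 4 s) ((res k + 2 * quo k) %% 5) | k <- zs].

Definition move_ok (l v : seq nat) (g : nat * nat * nat * bool) : bool :=
  let: (u, a, b, sw) := g in
  (0 < u < 5) && (a < 5) && (b < 5) &&
  all (fun k => nth 0 v (ton (move_box u a b sw k)) == nth 0 l (ton k)) zs.
Definition moves : seq (nat * nat * nat * bool) :=
  [seq (x, sw) | x <- [seq (x, b) | x <- [seq (u, a) | u <- iota 1 4, a <- iota 0 5],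
                                   b <- iota 0 5], sw <- [:: false; true]].
Definition agrees (l v : seq nat) (g : nat * nat * nat * bool) : bool :=
  let: (u, a, b, sw) := g in
  (fix agree ks := if ks is k :: ks' then
     if nth 0 v (ton (move_box u a b sw k)) == nth 0 l (ton k) then agree ks' else false
   else true) zs.
(** Untrusted, its results are validated by [classes_ok]. The failure value claims the all-ones
    type, which no box vector matches because of its zero at the origin. *)
Definition classify (v : seq nat) : nat * (nat * nat * nat * bool) :=
  let ms := moves in
  (fix seek i ls := if ls is l :: ls' then
     (fix try gs := if gs is g :: gs' then if agrees l v g then (i, g) else try gs'
        else seek i.+1 ls') ms
   else (0, (1, 0, 0, false))) 0 box_types.
Definition classes := Eval vm_compute in [seq classify (box_vector s) | s <- compositions 8 5].
Lemma classes_ok :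
  all2 (fun s c => (c.1 < size box_types) && move_ok (nth [::] box_types c.1) (box_vector s) c.2)
    (compositions 8 5) classes.
Proof. by vm_compute. Qed.
Lemma classP s : size s = 8 -> sumn s = 5 ->
  exists l g, l \in box_types /\ move_ok l (box_vector s) g.
Proof.
move=> h8 h5; have := mem_compositions s; rewrite h8 h5.
move: classes_ok; elim: (compositions 8 5) classes => // s' ss IH [//|c cs] /=.
case/andP=> /andP[hc hm] /IH{}IH; rewrite inE => /orP[/eqP->|/IH//].
by exists (nth [::] box_types c.1), c.2; rewrite mem_nth.
Qed.

Ltac line_sum e := have := e; rewrite -big_filter;
  match goal with |- context [filter ?P zs] =>
    let t := eval vm_compute in (filter P zs) in change (filter P zs) with t end;
  rewrite unlock /=.

Section Boxes.
Variable N : z25 -> nat.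
Hypothesis row : forall r, r < 5 -> \sum_(k <- zs | quo k == r) N k = 5.
Hypothesis col : forall r, r < 5 -> \sum_(k <- zs | res k == r) N k = 5.
Hypothesis diag : forall r, r < 5 -> \sum_(k <- zs | (res k + 5 - quo k) %% 5 == r) N k = 5.
Hypothesis anti : forall r, r < 5 -> \sum_(k <- zs | (quo k + res k) %% 5 == r) N k = 5.

(** Five positive integers with sum 5 are all 1. *)
Lemma balanced_ones : (forall k, 0 < N k) -> forall k, N k = 1.
Proof.
move=> h k.
have := h z0; have := h z1; have := h z2; have := h z3; have := h z4.
have := h z5; have := h z6; have := h z7; have := h z8; have := h z9.
have := h z10; have := h z11; have := h z12; have := h z13; have := h z14.
have := h z15; have := h z16; have := h z17; have := h z18; have := h z19.
have := h z20; have := h z21; have := h z22; have := h z23; have := h z24.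
line_sum (row (erefl : 0 < 5)); line_sum (row (erefl : 1 < 5)); line_sum (row (erefl : 2 < 5)).
line_sum (row (erefl : 3 < 5)); line_sum (row (erefl : 4 < 5)).
by case: k => /=; lia.
Qed.

(** The entries in [s] are those on the lines b + 2 a = 0 and b - 2 a = 0 through the origin, where
    one of the two summands vanishes: they are f(1), ..., f(4) and g(1), ..., g(4). Row 0 shows that
    their sum is 5. *)
Lemma balanced_vector : N z0 = 0 ->
  let s := [:: N z8; N z11; N z19; N z22; N z23; N z16; N z14; N z7] in
  sumn s = 5 /\ [seq N k | k <- zs] = box_vector s.
Proof.
move=> h0.
line_sum (row (erefl : 0 < 5)); line_sum (row (erefl : 1 < 5)); line_sum (row (erefl : 2 < 5)).
line_sum (row (erefl : 3 < 5)); line_sum (row (erefl : 4 < 5)).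
line_sum (col (erefl : 0 < 5)); line_sum (col (erefl : 1 < 5)); line_sum (col (erefl : 2 < 5)).
line_sum (col (erefl : 3 < 5)); line_sum (col (erefl : 4 < 5)).
line_sum (diag (erefl : 0 < 5)); line_sum (diag (erefl : 1 < 5)); line_sum (diag (erefl : 2 < 5)).
line_sum (diag (erefl : 3 < 5)); line_sum (diag (erefl : 4 < 5)).
line_sum (anti (erefl : 0 < 5)); line_sum (anti (erefl : 1 < 5)); line_sum (anti (erefl : 2 < 5)).
line_sum (anti (erefl : 3 < 5)); line_sum (anti (erefl : 4 < 5)).
rewrite /box_vector /zs /= h0.
move: (N z1) (N z2) (N z3) (N z4) (N z5) (N z6) (N z7) (N z8) (N z9) (N z10) (N z11) (N z12)
  (N z13) (N z14) (N z15) (N z16) (N z17) (N z18) (N z19) (N z20) (N z21) (N z22) (N z23) (N z24).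
move=> n1 n2 n3 n4 n5 n6 n7 n8 n9 n10 n11 n12 n13 n14 n15 n16 n17 n18 n19 n20 n21 n22 n23 n24.
move=> e1 e2 e3 e4 e5 e6 e7 e8 e9 e10 e11 e12 e13 e14 e15 e16 e17 e18 e19 e20.
split; first lia.
have cons_eq (a b : nat) r t : a = b -> r = t -> a :: r = b :: t by move=> -> ->.
by do ![apply: (cons_eq); first by lia].
Qed.
End Boxes.

Section GoodBoxes.
Variables (p : z25 -> z25) (gp : good p).

Lemma boxcount_row r : r < 5 -> \sum_(k <- zs | quo k == r) boxcount p k = 5.
Proof. by move=> hr; apply: (@class_sum p id) => // x; apply: quo_zbox. Qed.
Lemma boxcount_col r : r < 5 -> \sum_(k <- zs | res k == r) boxcount p k = 5.
Proof. by move=> hr; apply: (@class_sum p p) => // [|x]; [apply: good_inj|apply: res_zbox]. Qed.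
Lemma boxcount_diag r : r < 5 ->
  \sum_(k <- zs | (res k + 5 - quo k) %% 5 == r) boxcount p k = 5.
Proof.
move=> hr; apply: (class_sum (good_diff gp)) => // x; rewrite quo_zbox res_zbox.
by apply/eqP; move: x (p x); apply: brute2; vm_compute.
Qed.
Lemma boxcount_anti r : r < 5 ->
  \sum_(k <- zs | (quo k + res k) %% 5 == r) boxcount p k = 5.
Proof.
move=> hr; apply: (class_sum (good_sum gp)) => // x; rewrite quo_zbox res_zbox.
by apply/eqP; move: x (p x); apply: brute2; vm_compute.
Qed.
End GoodBoxes.

Lemma no_good : (forall l, l \in box_types -> infeasible (caps_of l)) -> forall p, ~ good p.
Proof.
move=> hinf p gp.
have [/allP hpos|] := boolP (all (fun k => 0 < boxcount p k) zs).
  apply: (hinf (nth [::] box_types 0) (mem_nth _ _) p gp) => //.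
  move=> k; rewrite aget_amake (balanced_ones (boxcount_row p)) => [|j]; first by case: k.
  exact: hpos (mem_zs j).
rewrite -has_predC => /hasP[k _]; rewrite /= -eqn0Ngt => /eqP hk.
(* Translate the empty box k to the origin. *)
have [q [gq bq _]] := symmetric_copy (ofn (quo k)) (ofn (res k)) false (erefl : zunit z1) gp.
have q0 : boxcount q z0 = 0.
  rewrite bq -hk; congr boxcount; apply/eqP; move: k {hk q gq bq}; apply: brute1; vm_compute; done.
have [h5 hv] := balanced_vector (boxcount_row q) (boxcount_col gq) (boxcount_diag gq)
  (boxcount_anti gq) q0.
have [//|l [[[[u a] b] sw] [hl]]] := classP _ h5.
case/andP=> /andP[/andP[hu ha] hb] /allP hm.
have ru : res (ofn u) = u by rewrite res_ofn modn_small; lia.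
have uu : zunit (ofn u) by rewrite zunitE ru; lia.
(* The move of boxes found by the classification lifts to a symmetry of the whole board. *)
have [r [gr br _]] := symmetric_copy (ofn a) (ofn b) sw uu gq.
apply: (hinf l hl r gr) => j; rewrite br aget_amake -(eqP (hm j (mem_zs j))) -hv.
rewrite ru !res_ofn !modn_small //; move: (move_box _ _ _ _ _) => i.
by rewrite (nth_map z0) ?ton_lt //; congr boxcount; case: i.
Qed.

(** * Form of the checker for evaluation, and growing lists of refuted shapes *)

(** The checker with its tables abstracted, so that their unfolded bodies can be passed as arguments
    in [refutes_fast]. The result is convertible to [refutes], for which soundness is known. *)
Definition refutes_with := ltac:(
  let t := eval cbv delta [refutes check flat state_of state0 amake mk5 full elements alive
    place cellx celly open_line partial missing follow2 follow3 follow4 follow5 follow6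
    occupied_all occupied movex movey rsel sym_ok symmetries nth foldr fst snd predn]
    in refutes in
  let t := eval pattern (@aget (option z25)), (@aget nat), (@amod (option z25)), (@amod nat),
    zadd, zsub, zmul, zeq, zdbl, zopp, zbox, boxx, boxy, halfsub, halfadd, mbit, mclear,
    rland0, rland1, rland2, rland3, rland4, digz0, digz1, digz2, digz3, digz4,
    decode, bytez in t in
  lazymatch t with
  | ?f _ _ _ _ _ _ _ _ _ _ _ _ _ _ _ _ _ _ _ _ _ _ _ _ _ _ _ _ _ => exact f
  end).
Notation refutes_tables :=
  (refutes_with (@aget (option z25)) (@aget nat) (@amod (option z25)) (@amod nat)
    zadd zsub zmul zeq zdbl zopp zbox boxx boxy halfsub halfadd mbit mclear
    rland0 rland1 rland2 rland3 rland4 digz0 digz1 digz2 digz3 digz4 decode bytez).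
Definition refutes_fast := Eval cbv delta [aget amod zadd zsub zmul zeq zdbl zopp zbox boxx
    boxy halfsub halfadd mbit mclear rland0 rland1 rland2 rland3 rland4
    digz0 digz1 digz2 digz3 digz4 decode bytez] in refutes_tables.
Lemma refutes_withE : refutes_tables = refutes. Proof. reflexivity. Qed.
Lemma refutes_fastE : refutes_fast = refutes_tables. Proof. reflexivity. Qed.

Definition all_refuted (cap : caps) (l : seq shape) : Prop :=
  forall sh, sh \in l -> refuted cap sh.
Lemma refuted_nil cap : all_refuted cap [::]. Proof. by []. Qed.
Lemma refuted_cons n cap sh l r : all_refuted cap l ->
  refutes_fast n cap l sh r = true -> all_refuted cap (sh :: l).
Proof.
move=> hl; rewrite refutes_fastE refutes_withE => hr sh'; rewrite inE => /orP[/eqP->|/hl//].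
exact: refutes_sound hl hr.
Qed.
Lemma refuted_head cap sh l : all_refuted cap (sh :: l) -> all_refuted cap [:: sh].
Proof. by move=> h sh'; rewrite inE => /eqP->; apply: h; apply: mem_head. Qed.
(* The search that produces the certificates; nothing is proved about it. *)
Record cell := Cell { cx : z25; cy : z25; cd : z25; cs : z25 }.
Definition mkcell (x y : z25) : cell := Cell x y (zsub y x) (zadd x y).
Record sstate := SState { base : state; inv : arr (option z25); queens : seq cell }.
Inductive line := Line (v : dir) (k : z25) (m : mask).

Definition zlt := Eval vm_compute in tab2 (fun a b => ton a < ton b).
Definition zcongr := Eval vm_compute in tab2 (fun a b => res a == res b).
Definition mland (w b : mask) : mask :=
  let: P5 w0 w1 w2 w3 w4 := w in let: P5 b0 b1 b2 b3 b4 := b in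
  P5 (rland0 w0 b0) (rland0 w1 b1) (rland0 w2 b2) (rland0 w3 b3) (rland0 w4 b4).
Definition unattacked := Eval vm_compute in
  tab2 (fun e y => mclear y (mclear (zadd y e) (mclear (zsub y e) full))).
Definition unattacked_box := Eval vm_compute in
  tab2 (fun x y => mk5 (fun s => dmake (fun t =>
    let a := ofn (5 * s) in let b := ofn (5 * t) in
    ~~ [|| zeq a x, zeq b y, zeq (zsub b a) (zsub y x) | zeq (zadd a b) (zadd x y)]))).
Definition clear_class := Eval vm_compute in
  fun (z : z25) (m : mask) => let: P5 a b c d e := m in
  case25 (fun z => upd (res z) (fun=> d0) (P5 a b c d e)) z.
(* as [unattacked], for a queen that fills its box *)
Definition unattacked_full := Eval vm_compute in
  tab2 (fun e y => if zcongr e z0 then clear_class y (unattacked e y) else unattacked e y).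
Definition pop1 := Eval vm_compute in
  case32 (fun d => ofn (foldr (fun u n => bit u d + n) 0 (iota 0 5))).
Definition pop2 := Eval vm_compute in
  fun a b => case32 (fun a => case32 (fun b => zadd (pop1 a) (pop1 b)) b) a.
Definition add_sat := Eval vm_compute in tab2 (fun a b => ofn (minn 24 (ton a + ton b))).
Definition popcount (m : mask) : z25 :=
  let: P5 a b c d e := m in add_sat (zadd (pop2 a b) (pop2 c d)) (pop1 e).

Fixpoint forward (n : nat) (f : arr (option z25)) (i a : z25) : option (nat * z25) :=
  if n is n'.+1 then
    if aget f a is Some b then forward n' f i (zsub b i) else Some (n', a)
  else None.
Fixpoint backward (n : nat) (g : arr (option z25)) (i a : z25) : option z25 :=
  if n is n'.+1 then
    let c := zadd a i in if aget g c is Some b then backward n' g i b else Some c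
  else None.
Definition add_dead (s : state) (x y : z25) (acc : seq cell) : seq cell :=
  let: State _ _ md ms _ _ _ _ _ _ := s in
  let d := zsub y x in
  if mbit d md then
    let e := zadd x y in if mbit e ms then Cell x y d e :: acc else acc
  else acc.
(* The cells that would close a cycle of length at most 7 through [(x, y)]. *)
Fixpoint cycle_dead (l : seq cell) (f g : arr (option z25)) (x y sq : z25) (s : state)
    (acc : seq cell) : seq cell :=
  if l is Cell a b _ sp :: l' then
    let acc :=
      let u := zsub sp y in let c := zsub sq a in
      match aget f u with
      | None => match aget g c with
        | None => add_dead s u c acc
        | Some w => if backward 4 g (zsub y a) w is Some c then add_dead s u c acc else acc
        end
      | Some w => let i := zsub y a in
        if forward 5 f i (zsub w i) is Some (n, u) then
          if backward n g i x is Some c then add_dead s u c acc else acc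
        else acc
      end in
    let acc :=
      let u := zsub sq b in let c := zsub sp x in
      match aget f u, aget g c with
      | None, None => add_dead s u c acc
      | _, _ => let i := zsub b x in
        if forward 6 f i u is Some (n, u) then
          if backward n.+1 g i x is Some c then add_dead s u c acc else acc
        else acc
      end in
    cycle_dead l' f g x y sq s acc
  else acc.

Definition byte_of (n : nat) : byte := if Byte.of_nat n is Some b then b else x00.
Definition line_byte := Eval vm_compute in fun (v : dir) =>
  match v with
  | Row => case25 (fun k => byte_of (ton k))
  | Col => case25 (fun k => byte_of (25 + ton k))
  | Diag => case25 (fun k => byte_of (50 + ton k))
  | Anti => case25 (fun k => byte_of (75 + ton k))
  | Box => case25 (fun k => byte_of (100 + ton k))
  end.
Definition cycle_byte := Eval vm_compute in fun (n : nat) =>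
  match n with
  | 2 => case25 (fun k => byte_of (125 + ton k))
  | 3 => case25 (fun k => byte_of (150 + ton k))
  | 4 => case25 (fun k => byte_of (175 + ton k))
  | 5 => case25 (fun k => byte_of (200 + ton k))
  | _ => case25 (fun k => byte_of (225 + ton k))
  end.
Fixpoint closing (n m : nat) (f : arr (option z25)) (i x a : z25) : option nat :=
  if n is n'.+1 then
    if aget f a is Some b then
      let c := zsub b i in if zeq c x then Some m else closing n' m.+1 f i x c
    else None
  else None.
Fixpoint cycle_reason (l : seq cell) (f : arr (option z25)) (x y : z25) : option byte :=
  if l is Cell a b _ sp :: l' then
    let u := zsub sp y in
    if aget f u is Some c then
      let i := zsub y a in let w := zsub c i in
      if zeq w x then Some (cycle_byte 2 i) else
      if closing 4 3 f i x w is Some m then Some (cycle_byte m i)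
      else cycle_reason l' f x y
    else cycle_reason l' f x y
  else None.

(* An image of a forbidden shape through a cell [p]: the positions relative to [p]
   of its other cells and of the origin, and the symmetry. *)
Record image :=
  Image { ithird : option (z25 * z25); iox : z25; ioy : z25; iu : z25; isw : bool; ij : nat }.
Record context := Context {
  syms : arr (p5 (bool * bool));
  triples : option (arr (arr (seq image)));
  pairs : option (arr (arr (seq image)));
  pair_lists : arr (seq (z25 * z25 * image)) }.

Definition image_ok (c : context) (e : image) (p : cell) : bool :=
  sym_ok (syms c) (iu e) (zsub (cx p) (iox e)) (zsub (cy p) (ioy e)) (isw e).
Definition unattackedb (s : state) (c : cell) : bool :=
  let: State mx my md ms _ _ _ _ _ _ := s in
  if mbit (cx c) mx then if mbit (cy c) my then
    if mbit (cd c) md then mbit (cs c) ms else false else false else false.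
Fixpoint triple_dead1 (c : context) (es : seq image) (p : cell) (s : state) (acc : seq cell)
    : seq cell :=
  if es is e :: es' then
    triple_dead1 c es' p s
      (if ithird e is Some (a, b) then
         let k := mkcell (zadd (cx p) a) (zadd (cy p) b) in
         if unattackedb s k then if image_ok c e p then k :: acc else acc else acc
       else acc)
  else acc.
Fixpoint triple_dead (c : context) (t : arr (arr (seq image))) (l : seq cell) (x y : z25)
    (s : state) (acc : seq cell) : seq cell :=
  if l is p :: l' then
    triple_dead c t l' x y s
      (triple_dead1 c (aget (aget t (zsub x (cx p))) (zsub y (cy p))) p s acc)
  else acc.
Fixpoint pair_dead (l : seq (z25 * z25 * image)) (q : cell) (s : state) (acc : seq cell)
    : seq cell :=
  if l is (a, b, e) :: l' then
    pair_dead l' q s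
      (let k := mkcell (zadd (cx q) a) (zadd (cy q) b) in
       if unattackedb s k then k :: acc else acc)
  else acc.
Fixpoint image_reason1 (c : context) (es : seq image) (p : cell) (f : arr (option z25))
    (acc : seq byte) : option (seq byte) :=
  if es is e :: es' then
    if (if ithird e is Some (a, b) then
          if aget f (zadd (cx p) a) is Some w then zeq w (zadd (cy p) b) else false
        else true) && image_ok c e p
    then Some [:: byte_of (ij e), line_byte Row (zsub (cy p) (ioy e)),
                 line_byte Row (zsub (cx p) (iox e)), line_byte Row (iu e),
                 (if isw e then xfc else xfb) & acc]
    else image_reason1 c es' p f acc
  else None.
Fixpoint image_reason (c : context) (t : arr (arr (seq image))) (l : seq cell) (x y : z25)
    (f : arr (option z25)) (acc : seq byte) : option (seq byte) :=
  if l is p :: l' then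
    if image_reason1 c (aget (aget t (zsub x (cx p))) (zsub y (cy p))) p f acc is Some r
    then Some r else image_reason c t l' x y f acc
  else None.
Definition reason (c : context) (s : sstate) (x y : z25) (acc : seq byte) : option (seq byte) :=
  if aget (missing (base s)) (zbox x y) is 0 then Some (xfa :: acc) else
  if cycle_reason (queens s) (partial (base s)) x y is Some b then Some (b :: acc) else
  if (if pairs c is Some t then image_reason c t (queens s) x y (partial (base s)) acc
      else None) is Some r then Some r else
  if triples c is Some t then image_reason c t (queens s) x y (partial (base s)) acc
  else None.

Record dead_cells := Deads { dl : seq cell; dx : mask; dy : mask; dd : mask; de : mask; db : mask }.
Fixpoint deads (l l0 : seq cell) (a b c d e : mask) : dead_cells :=
  if l is Cell x y u v :: l' then
    deads l' l0 (mclear x a) (mclear y b) (mclear u c) (mclear v d) (mclear (zbox x y) e)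
  else Deads l0 a b c d e.
Definition touched (ks : dead_cells) (v : dir) : mask :=
  match v with Row => dx ks | Col => dy ks | Diag => dd ks | Anti => de ks | Box => db ks end.
Definition lrow (v : dir) (c : cell) : z25 :=
  match v with
  | Row => cx c | Col => cy c | Diag => cd c | Anti => cs c | Box => zbox (cx c) (cy c)
  end.
Definition box_index := Eval vm_compute in tab2 (fun x y => ofn (quo x + 5 * quo y)).
Definition lcol (v : dir) (c : cell) : z25 :=
  match v with
  | Row => cy c | Col => cx c | Diag => cs c | Anti => cd c | Box => box_index (cx c) (cy c)
  end.
Fixpoint remove_dead (l : seq cell) (v : dir) (k : z25) (m : mask) : mask :=
  if l is c :: l' then
    remove_dead l' v k (if zeq (lrow v c) k then mclear (lcol v c) m else m)
  else m.
Definition boxax := Eval vm_compute in case25 (fun k => ofn (quo k)).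
Definition boxay := Eval vm_compute in case25 (fun k => ofn (res k)).

(* The long lines, by direction. *)
Inductive kline := K (k : z25) (m : mask).
Record klines := KLines {
  krow : seq kline; kcol : seq kline; kdiag : seq kline; kanti : seq kline; kbox : seq kline }.
Definition no_klines : klines := KLines [::] [::] [::] [::] [::].
Inductive scan (A : Type) :=
  Empty (v : dir) (k : z25)
| Best (short : seq line) (long : A) (n : z25) (v : dir) (k : z25) (m : mask).
Arguments Empty {A}.
Definition attacked (fb : bool) (q : cell) (v : dir) (k r : z25) (m : mask) : mask :=
  match v with
  | Box => mland m (unattacked_box (zsub (cx q) (boxax k)) (zsub (cy q) (boxay k)))
  | _ => mland m (if fb then unattacked_full (zsub k r) (lcol v q)
                  else unattacked (zsub k r) (lcol v q))
  end.
Definition mnil (m : mask) : bool :=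
  match m with P5 d0 d0 d0 d0 d0 => true | _ => false end.
Fixpoint attack (fb : bool) (ls : seq line) (q : cell) (acc : seq line) : scan unit :=
  if ls is Line v k m :: ls' then
    let r := lrow v q in
    if zeq k r then attack fb ls' q acc else
    let m := attacked fb q v k r m in
    if mnil m then Empty v k else attack fb ls' q (Line v k m :: acc)
  else Best acc tt z0 Row z0 full.
(* ties are broken against boxes *)
Definition better (c n : z25) (v bv : dir) : bool :=
  if zlt c n then true else
  match bv, v with
  | Box, Box => false
  | Box, _ => zeq c n
  | _, _ => false
  end.
Fixpoint prune (ls : seq line) (ks : dead_cells) (short : seq line)
    (n : z25) (bv : dir) (bk : z25) (bm : mask) : scan unit :=
  if ls is Line v k m :: ls' then
    let m := if mbit k (touched ks v) then m else remove_dead (dl ks) v k m in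
    let c := popcount m in
    if c is z0 then Empty v k else
    if better c n v bv then prune ls' ks (Line v k m :: short) c v k m
    else prune ls' ks (Line v k m :: short) n bv bk bm
  else Best short tt n bv bk bm.
(** A quick test: more than two cells in two digits already show that a line is not short, without a
    full count. *)
Definition many := Eval vm_compute in
  fun a b => case32 (fun a => case32 (fun b => 2 < ton (pop1 a) + ton (pop1 b)) b) a.
Fixpoint update (v : dir) (tab : z25 -> z25 -> mask) (ls : seq kline) (r y : z25) (td : mask)
    (dl : seq cell) (short : seq line) (acc : seq kline)
    (n : z25) (bv : dir) (bk : z25) (bm : mask) : scan (seq kline) :=
  if ls is K k m :: ls' then
    if zeq k r then update v tab ls' r y td dl short acc n bv bk bm else
    let m := mland m (tab (zsub k r) y) in
    let m := if mbit k td then m else remove_dead dl v k m in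
    let: P5 a b c d e := m in
    if many b c then update v tab ls' r y td dl short (K k m :: acc) n bv bk bm else
    if many d e then update v tab ls' r y td dl short (K k m :: acc) n bv bk bm else
    let c := popcount m in
    match c with
    | z0 => Empty v k
    | z1 | z2 =>
      if better c n v bv then update v tab ls' r y td dl (Line v k m :: short) acc c v k m
      else update v tab ls' r y td dl (Line v k m :: short) acc n bv bk bm
    | _ => update v tab ls' r y td dl short (K k m :: acc) n bv bk bm
    end
  else Best short acc n bv bk bm.
Fixpoint update_box (ls : seq kline) (q : cell) (r : z25) (td : mask)
    (dl : seq cell) (short : seq line) (acc : seq kline)
    (n : z25) (bv : dir) (bk : z25) (bm : mask) : scan (seq kline) :=
  if ls is K k m :: ls' then
    if zeq k r then update_box ls' q r td dl short acc n bv bk bm else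
    let m := attacked false q Box k r m in
    let m := if mbit k td then m else remove_dead dl Box k m in
    let c := popcount m in
    match c with
    | z0 => Empty Box k
    | z1 | z2 =>
      if zlt c n then update_box ls' q r td dl (Line Box k m :: short) acc c Box k m
      else update_box ls' q r td dl (Line Box k m :: short) acc n bv bk bm
    | _ => update_box ls' q r td dl short (K k m :: acc) n bv bk bm
    end
  else Best short acc n bv bk bm.
Fixpoint shortest_k (v : dir) (ls : seq kline) (r : z25 * dir * z25 * mask)
    : z25 * dir * z25 * mask :=
  if ls is K k m :: ls' then
    let c := popcount m in
    shortest_k v ls' (let: (n, bv, _, _) := r in if better c n v bv then (c, v, k, m) else r)
  else r.
Definition shortest_line (l : klines) : z25 * dir * z25 * mask :=
  shortest_k Box (kbox l) (shortest_k Anti (kanti l) (shortest_k Diag (kdiag l)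
    (shortest_k Col (kcol l) (shortest_k Row (krow l) (z24, Row, z0, full))))).
Definition update_all (fb : bool) (l : klines) (q : cell) (ks : dead_cells)
    (short : seq line) (n : z25) (v : dir) (k : z25) (m : mask) : scan klines :=
  let tab := if fb then unattacked_full else unattacked in
  match update Row tab (krow l) (cx q) (cy q) (dx ks) (dl ks) short [::] n v k m with
  | Empty v k => Empty v k
  | Best short l1 n v k m =>
  match update Col tab (kcol l) (cy q) (cx q) (dy ks) (dl ks) short [::] n v k m with
  | Empty v k => Empty v k
  | Best short l2 n v k m =>
  match update Diag tab (kdiag l) (cd q) (cs q) (dd ks) (dl ks) short [::] n v k m with
  | Empty v k => Empty v k
  | Best short l3 n v k m =>
  match update Anti tab (kanti l) (cs q) (cd q) (de ks) (dl ks) short [::] n v k m with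
  | Empty v k => Empty v k
  | Best short l4 n v k m =>
  match update_box (kbox l) q (zbox (cx q) (cy q)) (db ks) (dl ks) short [::] n v k m with
  | Empty v k => Empty v k
  | Best short l5 n v k m => Best short (KLines l1 l2 l3 l4 l5) n v k m
  end end end end end.

Fixpoint atmost (c : z25) (ls : seq kline) : seq kline :=
  if ls is K k m :: ls' then
    if zlt c (popcount m) then atmost c ls' else K k m :: atmost c ls'
  else [::].
Definition truncate (c : z25) (l : klines) : klines :=
  KLines (atmost c (krow l)) (atmost c (kcol l)) (atmost c (kdiag l)) (atmost c (kanti l))
    (atmost c (kbox l)).
Definition lines_number (l : klines) : nat :=
  size (krow l) + size (kcol l) + size (kdiag l) + size (kanti l) + size (kbox l).
Fixpoint shortest (n : nat) (cs : seq z25) (l : klines) : klines :=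
  if cs is c :: cs' then
    let l' := truncate c l in if n <= lines_number l' then l' else shortest n cs' l
  else l.
Definition live_mask (c : context) (s : sstate) (v : dir) (k : z25) : mask :=
  let m := alive (base s) v k in
  foldr (fun t m => if reason c s (cellx v k t) (celly v k t) [::] is Some _
                    then mclear t m else m) m (elements m).
Definition lines_of (c : context) (s : sstate) (v : dir) : seq kline :=
  [seq K k (live_mask c s v k) | k <- zs
    & open_line (base s) v k && (if v is Box then aget (missing (base s)) k == 1 else true)].
Definition all_lines (c : context) (s : sstate) : klines :=
  KLines (lines_of c s Row) (lines_of c s Col) (lines_of c s Diag) (lines_of c s Anti)
    (lines_of c s Box).

Definition splace (s : sstate) (x y : z25) : sstate :=
  SState (place (base s) x y) (amod (fun=> Some x) (inv s) y) (mkcell x y :: queens s).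
Definition dead_after (c : context) (s : sstate) (s' : state) (x y : z25) : dead_cells :=
  let l := cycle_dead (queens s) (partial (base s)) (inv s) x y (zadd x y) s' [::] in
  let l := if triples c is Some t then triple_dead c t (queens s) x y s' l else l in
  let l := pair_dead (aget (pair_lists c) (zbox x y)) (mkcell x y) s' l in
  deads l l full full full full full.

(** Short lines are treated first, as the likeliest to become empty, and the long ones are updated
    afterwards. The count [z24] is the initial value of the minimum and stands for no short line
    found. *)
Definition rescan (c : context) (s s' : sstate) (short : seq line) (long : klines)
    (x y : z25) : scan klines :=
  let b := zbox x y in
  let w := aget (missing (base s')) b in
  let fb := if w is 0 then true else false in
  let q := mkcell x y in
  match attack fb short q [::] with
  | Empty v k => Empty v k
  | Best short _ _ _ _ _ =>
    let ks := dead_after c s (base s') x y in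
    match prune short ks [::] z24 Row z0 full with
    | Empty v k => Empty v k
    | Best short _ n v k m =>
      match update_all fb long q ks short n v k m with
      | Empty v k => Empty v k
      | Best short long n v k m =>
        let: (n, v, k, m) := if n is z24 then shortest_line long else (n, v, k, m) in
        if w is 1 then
          let m' := live_mask c s' Box b in let c := popcount m' in
          if c is z0 then Empty Box b else
          if zlt c n then Best (Line Box b m' :: short) long c Box b m'
          else Best (Line Box b m' :: short) long n v k m
        else Best short long n v k m
      end
    end
  end.

(* [m] is the set of live cells of the line [(v, k)]; the certificate is produced
   in reverse order. *)
Fixpoint find (c : context) (n : nat) (s : sstate) (short : seq line) (long : klines)
    (v : dir) (k : z25) (m : mask) (acc : seq byte) : seq byte :=
  if n is n'.+1 then
    (fix emit (ts : seq z25) (acc : seq byte) : seq byte :=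
      if ts is t :: ts' then
        let x := cellx v k t in let y := celly v k t in
        emit ts' (
          if mbit t m then
            let s' := splace s x y in
            match rescan c s s' short long x y with
            (* With the empty mask every unattacked cell of this line receives a reason, which
               closes the branch. *)
            | Empty v k => find c n' s' [::] no_klines v k (P5 d0 d0 d0 d0 d0) acc
            | Best short long b v k m =>
              match short, b with
              | [::], z24 =>
                let ls := all_lines c s' in
                let: (_, v, k, m) := shortest_line ls in find c n' s' [::] ls v k m acc
              | _, _ =>
                (* Here nine queens are on the board; from now on only the lines with fewest live
                   cells, if possible at least 25 of them, are tracked. *)
                let long := if n' == 17 then shortest 25 [:: z4; z5; z6; z7; z8] long else long in
                find c n' s' short long v k m acc
              end
            end
          else if reason c s x y acc is Some acc then acc else acc)
      else acc) (elements (alive (base s) v k)) (line_byte v k :: acc)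
  else acc.

Definition units : seq z25 := [seq z <- zs | zunit z].
Definition csub (a b : z25 * z25) : z25 * z25 := (zsub a.1 b.1, zsub a.2 b.2).
Definition add_image (d : z25 * z25) (e : image) (t : arr (arr (seq image))) :=
  amod (fun r => amod (cons e) r d.2) t d.1.
Definition images (sh : shape) (j : nat) : seq (z25 * z25 * image) :=
  flatten [seq
    let g := [seq (movex us.1 z0 us.2 c, movey us.1 z0 us.2 c) | c <- sh] in
    let im a d := Image d a.1 a.2 us.1 us.2 j in
    match g with
    | [:: a; b] => [:: (csub b a, im a None); (csub a b, im b None)]
    | [:: a; b; c] =>
      [:: (csub b a, im a (Some (csub c a))); (csub c a, im a (Some (csub b a)));
          (csub a b, im b (Some (csub c b))); (csub c b, im b (Some (csub a b)));
          (csub a c, im c (Some (csub b c))); (csub b c, im c (Some (csub a c)))]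
    | _ => [::]
    end | us <- [seq (u, sw) | u <- units, sw <- [:: false; true]]].
Definition table_of (l : seq (z25 * z25 * image)) : option (arr (arr (seq image))) :=
  if l is [::] then None
  else Some (foldr (fun e => add_image e.1 e.2) (amake (fun=> amake (fun=> [::]))) l).
Definition context_of (cap : caps) (forbidden : seq shape) : context :=
  let l := flatten [seq images js.2 js.1 | js <- zip (iota 0 (size forbidden)) forbidden] in
  let l2 := [seq e <- l | if ithird e.2 is None then true else false] in
  let l3 := [seq e <- l | if ithird e.2 is None then false else true] in
  let st := symmetries cap in
  Context st (table_of l3) (table_of l2)
    (amake (fun k => [seq e <- l2 |
       sym_ok st (iu e.2) (zsub (boxax k) (iox e.2)) (zsub (boxay k) (ioy e.2)) (isw e.2)])).

Fixpoint leaves (n : nat) (cur l : seq byte) (acc : seq rope) : seq rope :=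
  if l is x :: l' then
    if n is 15 then
      if x :: cur is [:: a; b; c; d; e; f; g; h; i; j; k; y; m; n; o; p]
      then leaves 0 [::] l' (Leaf16 a b c d e f g h i j k y m n o p :: acc) else acc
    else leaves n.+1 (x :: cur) l' acc
  else acc.
Fixpoint padding (n : nat) (l : seq byte) : nat :=
  if l is _ :: l' then padding (if n is 0 then 15 else n.-1) l' else n.
Fixpoint join2 (l : seq rope) : seq rope :=
  if l is a :: b :: l' then Node a b :: join2 l' else l.
Definition rope_of (l : seq byte) : rope :=
  head (Leaf16 x00 x00 x00 x00 x00 x00 x00 x00 x00 x00 x00 x00 x00 x00 x00 x00)
    (* The stream is still reversed, so these zero bytes end up behind the certificate, where the
       final continuation [xpredT] ignores them. *)
    (iter 40 join2 (leaves 0 [::] (nseq (padding 0 l) x00 ++ l) [::])).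

Definition search (cap : caps) (forbidden : seq shape) (sh : shape) : seq byte :=
  let c := context_of cap forbidden in
  let s := foldr (fun c s => splace s c.1 c.2)
    (SState (state0 cap) (amake (fun=> None)) [::]) sh in
  let ls := all_lines c s in
  let: (_, v, k, m) := shortest_line ls in find c (26 - size sh) s [::] ls v k m [::].
Definition certificate (l : seq shape) (cap : caps) : rope :=
  if l is sh :: l' then rope_of (search cap l' sh) else rope_of [::].

(** * The refutations, one box type after another *)

(** The fuel 26 is ample, since every nested call has one more queen on the board of 25 rows. *)
Ltac by_certificate c h :=
  refine (@refuted_cons 26 _ _ _ c h _); vm_cast_no_check (eq_refl true).

Definition cap0 : caps := Eval vm_compute in caps_of (nth [::] box_types 0).
(** One queen in every box. The pair (0, 0), (1, 6) is refuted after eight triples that extend it;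
    their third cells all lie on the diagonal y - x = 10. *)
Definition nogoods0_0 : seq shape := [:: (z22, z7); (z1, z6); (z0, z0)] :: [::].
Definition cert0_0 := Eval vm_compute in certificate nogoods0_0 cap0.
Lemma refuted0_0 : all_refuted cap0 nogoods0_0.
Proof. by_certificate cert0_0 (@refuted_nil cap0). Qed.
Definition nogoods0_1 : seq shape := [:: (z2, z12); (z1, z6); (z0, z0)] :: nogoods0_0.
Definition cert0_1 := Eval vm_compute in certificate nogoods0_1 cap0.
Lemma refuted0_1 : all_refuted cap0 nogoods0_1.
Proof. by_certificate cert0_1 (@refuted0_0). Qed.
Definition nogoods0_2 : seq shape := [:: (z12, z22); (z1, z6); (z0, z0)] :: nogoods0_1.
Definition cert0_2 := Eval vm_compute in certificate nogoods0_2 cap0.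
Lemma refuted0_2 : all_refuted cap0 nogoods0_2.
Proof. by_certificate cert0_2 (@refuted0_1). Qed.
Definition nogoods0_3 : seq shape := [:: (z9, z19); (z1, z6); (z0, z0)] :: nogoods0_2.
Definition cert0_3 := Eval vm_compute in certificate nogoods0_3 cap0.
Lemma refuted0_3 : all_refuted cap0 nogoods0_3.
Proof. by_certificate cert0_3 (@refuted0_2). Qed.
Definition nogoods0_4 : seq shape := [:: (z18, z3); (z1, z6); (z0, z0)] :: nogoods0_3.
Definition cert0_4 := Eval vm_compute in certificate nogoods0_4 cap0.
Lemma refuted0_4 : all_refuted cap0 nogoods0_4.
Proof. by_certificate cert0_4 (@refuted0_3). Qed.
Definition nogoods0_5 : seq shape := [:: (z3, z13); (z1, z6); (z0, z0)] :: nogoods0_4.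
Definition cert0_5 := Eval vm_compute in certificate nogoods0_5 cap0.
Lemma refuted0_5 : all_refuted cap0 nogoods0_5.
Proof. by_certificate cert0_5 (@refuted0_4). Qed.
Definition nogoods0_6 : seq shape := [:: (z23, z8); (z1, z6); (z0, z0)] :: nogoods0_5.
Definition cert0_6 := Eval vm_compute in certificate nogoods0_6 cap0.
Lemma refuted0_6 : all_refuted cap0 nogoods0_6.
Proof. by_certificate cert0_6 (@refuted0_5). Qed.
Definition nogoods0_7 : seq shape := [:: (z4, z14); (z1, z6); (z0, z0)] :: nogoods0_6.
Definition cert0_7 := Eval vm_compute in certificate nogoods0_7 cap0.
Lemma refuted0_7 : all_refuted cap0 nogoods0_7.
Proof. by_certificate cert0_7 (@refuted0_6). Qed.
Definition nogoods0_8 : seq shape := [:: (z1, z6); (z0, z0)] :: nogoods0_7.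
Definition cert0_8 := Eval vm_compute in certificate nogoods0_8 cap0.
Lemma refuted0_8 : all_refuted cap0 nogoods0_8.
Proof. by_certificate cert0_8 (@refuted0_7). Qed.
(** Only the pair is kept as a forbidden shape: an image of one of the triples contains an image of
    the pair. *)
Definition nogoods0_9 : seq shape := [:: (z7, z12); (z0, z0)] :: [:: [:: (z1, z6); (z0, z0)]].
Definition cert0_9 := Eval vm_compute in certificate nogoods0_9 cap0.
Lemma refuted0_9 : all_refuted cap0 nogoods0_9.
Proof. by_certificate cert0_9 (refuted_head (@refuted0_8)). Qed.
Definition nogoods0_10 : seq shape := [:: (z0, z0)] :: nogoods0_9.
Definition cert0_10 := Eval vm_compute in certificate nogoods0_10 cap0.
Lemma refuted0_10 : all_refuted cap0 nogoods0_10.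
Proof. by_certificate cert0_10 (@refuted0_9). Qed.
Lemma infeasible0 : infeasible cap0.
Proof.
by apply: (@infeasible_corner cap0 z0 z0) => //; apply: refuted0_10; apply: mem_head.
Qed.

Definition cap1 : caps := Eval vm_compute in caps_of (nth [::] box_types 1).
(** In this type and the following ones, pairs of the corner queen with queens on a parallel line
    (here row 15) are refuted before the corner queen alone. *)
Definition nogoods1_0 : seq shape := [:: (z15, z3); (z0, z1)] :: [::].
Definition cert1_0 := Eval vm_compute in certificate nogoods1_0 cap1.
Lemma refuted1_0 : all_refuted cap1 nogoods1_0.
Proof. by_certificate cert1_0 (@refuted_nil cap1). Qed.
Definition nogoods1_1 : seq shape := [:: (z15, z12); (z0, z1)] :: nogoods1_0.
Definition cert1_1 := Eval vm_compute in certificate nogoods1_1 cap1.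
Lemma refuted1_1 : all_refuted cap1 nogoods1_1.
Proof. by_certificate cert1_1 (@refuted1_0). Qed.
Definition nogoods1_2 : seq shape := [:: (z15, z9); (z0, z1)] :: nogoods1_1.
Definition cert1_2 := Eval vm_compute in certificate nogoods1_2 cap1.
Lemma refuted1_2 : all_refuted cap1 nogoods1_2.
Proof. by_certificate cert1_2 (@refuted1_1). Qed.
Definition nogoods1_3 : seq shape := [:: (z0, z1)] :: nogoods1_2.
Definition cert1_3 := Eval vm_compute in certificate nogoods1_3 cap1.
Lemma refuted1_3 : all_refuted cap1 nogoods1_3.
Proof. by_certificate cert1_3 (@refuted1_2). Qed.
Lemma infeasible1 : infeasible cap1.
Proof.
by apply: (@infeasible_corner cap1 z0 z1) => //; apply: refuted1_3; apply: mem_head.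
Qed.

Definition cap2 : caps := Eval vm_compute in caps_of (nth [::] box_types 2).
Definition nogoods2_0 : seq shape := [:: (z5, z17); (z0, z1)] :: [::].
Definition cert2_0 := Eval vm_compute in certificate nogoods2_0 cap2.
Lemma refuted2_0 : all_refuted cap2 nogoods2_0.
Proof. by_certificate cert2_0 (@refuted_nil cap2). Qed.
Definition nogoods2_1 : seq shape := [:: (z5, z23); (z0, z1)] :: nogoods2_0.
Definition cert2_1 := Eval vm_compute in certificate nogoods2_1 cap2.
Lemma refuted2_1 : all_refuted cap2 nogoods2_1.
Proof. by_certificate cert2_1 (@refuted2_0). Qed.
Definition nogoods2_2 : seq shape := [:: (z5, z14); (z0, z1)] :: nogoods2_1.
Definition cert2_2 := Eval vm_compute in certificate nogoods2_2 cap2.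
Lemma refuted2_2 : all_refuted cap2 nogoods2_2.
Proof. by_certificate cert2_2 (@refuted2_1). Qed.
Definition nogoods2_3 : seq shape := [:: (z0, z1)] :: nogoods2_2.
Definition cert2_3 := Eval vm_compute in certificate nogoods2_3 cap2.
Lemma refuted2_3 : all_refuted cap2 nogoods2_3.
Proof. by_certificate cert2_3 (@refuted2_2). Qed.
Lemma infeasible2 : infeasible cap2.
Proof.
by apply: (@infeasible_corner cap2 z0 z1) => //; apply: refuted2_3; apply: mem_head.
Qed.

Definition cap3 : caps := Eval vm_compute in caps_of (nth [::] box_types 3).
Definition nogoods3_0 : seq shape := [:: (z13, z3); (z2, z2)] :: [::].
Definition cert3_0 := Eval vm_compute in certificate nogoods3_0 cap3.
Lemma refuted3_0 : all_refuted cap3 nogoods3_0.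
Proof. by_certificate cert3_0 (@refuted_nil cap3). Qed.
Definition nogoods3_1 : seq shape := [:: (z6, z21); (z2, z2)] :: nogoods3_0.
Definition cert3_1 := Eval vm_compute in certificate nogoods3_1 cap3.
Lemma refuted3_1 : all_refuted cap3 nogoods3_1.
Proof. by_certificate cert3_1 (@refuted3_0). Qed.
Definition nogoods3_2 : seq shape := [:: (z2, z2)] :: nogoods3_1.
Definition cert3_2 := Eval vm_compute in certificate nogoods3_2 cap3.
Lemma refuted3_2 : all_refuted cap3 nogoods3_2.
Proof. by_certificate cert3_2 (@refuted3_1). Qed.
Lemma infeasible3 : infeasible cap3.
Proof.
by apply: (@infeasible_corner cap3 z2 z2) => //; apply: refuted3_2; apply: mem_head.
Qed.

Definition cap4 : caps := Eval vm_compute in caps_of (nth [::] box_types 4).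
Definition nogoods4_0 : seq shape := [:: (z24, z5); (z1, z2)] :: [::].
Definition cert4_0 := Eval vm_compute in certificate nogoods4_0 cap4.
Lemma refuted4_0 : all_refuted cap4 nogoods4_0.
Proof. by_certificate cert4_0 (@refuted_nil cap4). Qed.
Definition nogoods4_1 : seq shape := [:: (z12, z18); (z1, z2)] :: nogoods4_0.
Definition cert4_1 := Eval vm_compute in certificate nogoods4_1 cap4.
Lemma refuted4_1 : all_refuted cap4 nogoods4_1.
Proof. by_certificate cert4_1 (@refuted4_0). Qed.
Definition nogoods4_2 : seq shape := [:: (z1, z2)] :: nogoods4_1.
Definition cert4_2 := Eval vm_compute in certificate nogoods4_2 cap4.
Lemma refuted4_2 : all_refuted cap4 nogoods4_2.
Proof. by_certificate cert4_2 (@refuted4_1). Qed.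
Lemma infeasible4 : infeasible cap4.
Proof.
by apply: (@infeasible_corner cap4 z1 z2) => //; apply: refuted4_2; apply: mem_head.
Qed.

Definition cap5 : caps := Eval vm_compute in caps_of (nth [::] box_types 5).
Definition nogoods5_0 : seq shape := [:: (z24, z11); (z3, z1)] :: [::].
Definition cert5_0 := Eval vm_compute in certificate nogoods5_0 cap5.
Lemma refuted5_0 : all_refuted cap5 nogoods5_0.
Proof. by_certificate cert5_0 (@refuted_nil cap5). Qed.
Definition nogoods5_1 : seq shape := [:: (z16, z11); (z3, z1)] :: nogoods5_0.
Definition cert5_1 := Eval vm_compute in certificate nogoods5_1 cap5.
Lemma refuted5_1 : all_refuted cap5 nogoods5_1.
Proof. by_certificate cert5_1 (@refuted5_0). Qed.
Definition nogoods5_2 : seq shape := [:: (z3, z1)] :: nogoods5_1.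
Definition cert5_2 := Eval vm_compute in certificate nogoods5_2 cap5.
Lemma refuted5_2 : all_refuted cap5 nogoods5_2.
Proof. by_certificate cert5_2 (@refuted5_1). Qed.
Lemma infeasible5 : infeasible cap5.
Proof.
by apply: (@infeasible_corner cap5 z3 z1) => //; apply: refuted5_2; apply: mem_head.
Qed.

Definition cap6 : caps := Eval vm_compute in caps_of (nth [::] box_types 6).
Definition nogoods6_0 : seq shape := [:: (z22, z1); (z1, z0)] :: [::].
Definition cert6_0 := Eval vm_compute in certificate nogoods6_0 cap6.
Lemma refuted6_0 : all_refuted cap6 nogoods6_0.
Proof. by_certificate cert6_0 (@refuted_nil cap6). Qed.
Definition nogoods6_1 : seq shape := [:: (z20, z24); (z1, z0)] :: nogoods6_0.
Definition cert6_1 := Eval vm_compute in certificate nogoods6_1 cap6.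
Lemma refuted6_1 : all_refuted cap6 nogoods6_1.
Proof. by_certificate cert6_1 (@refuted6_0). Qed.
Definition nogoods6_2 : seq shape := [:: (z1, z0)] :: nogoods6_1.
Definition cert6_2 := Eval vm_compute in certificate nogoods6_2 cap6.
Lemma refuted6_2 : all_refuted cap6 nogoods6_2.
Proof. by_certificate cert6_2 (@refuted6_1). Qed.
Lemma infeasible6 : infeasible cap6.
Proof.
by apply: (@infeasible_corner cap6 z1 z0) => //; apply: refuted6_2; apply: mem_head.
Qed.

Definition cap7 : caps := Eval vm_compute in caps_of (nth [::] box_types 7).
Definition nogoods7_0 : seq shape := [:: (z2, z11); (z1, z0)] :: [::].
Definition cert7_0 := Eval vm_compute in certificate nogoods7_0 cap7.
Lemma refuted7_0 : all_refuted cap7 nogoods7_0.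
Proof. by_certificate cert7_0 (@refuted_nil cap7). Qed.
Definition nogoods7_1 : seq shape := [:: (z20, z4); (z1, z0)] :: nogoods7_0.
Definition cert7_1 := Eval vm_compute in certificate nogoods7_1 cap7.
Lemma refuted7_1 : all_refuted cap7 nogoods7_1.
Proof. by_certificate cert7_1 (@refuted7_0). Qed.
Definition nogoods7_2 : seq shape := [:: (z1, z0)] :: nogoods7_1.
Definition cert7_2 := Eval vm_compute in certificate nogoods7_2 cap7.
Lemma refuted7_2 : all_refuted cap7 nogoods7_2.
Proof. by_certificate cert7_2 (@refuted7_1). Qed.
Lemma infeasible7 : infeasible cap7.
Proof.
by apply: (@infeasible_corner cap7 z1 z0) => //; apply: refuted7_2; apply: mem_head.
Qed.

Definition cap8 : caps := Eval vm_compute in caps_of (nth [::] box_types 8).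
Definition nogoods8_0 : seq shape := [:: (z5, z14); (z0, z3)] :: [::].
Definition cert8_0 := Eval vm_compute in certificate nogoods8_0 cap8.
Lemma refuted8_0 : all_refuted cap8 nogoods8_0.
Proof. by_certificate cert8_0 (@refuted_nil cap8). Qed.
Definition nogoods8_1 : seq shape := [:: (z5, z7); (z0, z3)] :: nogoods8_0.
Definition cert8_1 := Eval vm_compute in certificate nogoods8_1 cap8.
Lemma refuted8_1 : all_refuted cap8 nogoods8_1.
Proof. by_certificate cert8_1 (@refuted8_0). Qed.
Definition nogoods8_2 : seq shape := [:: (z0, z3)] :: nogoods8_1.
Definition cert8_2 := Eval vm_compute in certificate nogoods8_2 cap8.
Lemma refuted8_2 : all_refuted cap8 nogoods8_2.
Proof. by_certificate cert8_2 (@refuted8_1). Qed.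
Lemma infeasible8 : infeasible cap8.
Proof.
by apply: (@infeasible_corner cap8 z0 z3) => //; apply: refuted8_2; apply: mem_head.
Qed.

Definition cap9 : caps := Eval vm_compute in caps_of (nth [::] box_types 9).
Definition nogoods9_0 : seq shape := [:: (z10, z4); (z0, z2)] :: [::].
Definition cert9_0 := Eval vm_compute in certificate nogoods9_0 cap9.
Lemma refuted9_0 : all_refuted cap9 nogoods9_0.
Proof. by_certificate cert9_0 (@refuted_nil cap9). Qed.
Definition nogoods9_1 : seq shape := [:: (z10, z23); (z0, z2)] :: nogoods9_0.
Definition cert9_1 := Eval vm_compute in certificate nogoods9_1 cap9.
Lemma refuted9_1 : all_refuted cap9 nogoods9_1.
Proof. by_certificate cert9_1 (@refuted9_0). Qed.
Definition nogoods9_2 : seq shape := [:: (z0, z2)] :: nogoods9_1.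
Definition cert9_2 := Eval vm_compute in certificate nogoods9_2 cap9.
Lemma refuted9_2 : all_refuted cap9 nogoods9_2.
Proof. by_certificate cert9_2 (@refuted9_1). Qed.
Lemma infeasible9 : infeasible cap9.
Proof.
by apply: (@infeasible_corner cap9 z0 z2) => //; apply: refuted9_2; apply: mem_head.
Qed.

Definition cap10 : caps := Eval vm_compute in caps_of (nth [::] box_types 10).
Definition nogoods10_0 : seq shape := [:: (z6, z16); (z2, z2)] :: [::].
Definition cert10_0 := Eval vm_compute in certificate nogoods10_0 cap10.
Lemma refuted10_0 : all_refuted cap10 nogoods10_0.
Proof. by_certificate cert10_0 (@refuted_nil cap10). Qed.
Definition nogoods10_1 : seq shape := [:: (z3, z13); (z2, z2)] :: nogoods10_0.
Definition cert10_1 := Eval vm_compute in certificate nogoods10_1 cap10.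
Lemma refuted10_1 : all_refuted cap10 nogoods10_1.
Proof. by_certificate cert10_1 (@refuted10_0). Qed.
Definition nogoods10_2 : seq shape := [:: (z2, z2)] :: nogoods10_1.
Definition cert10_2 := Eval vm_compute in certificate nogoods10_2 cap10.
Lemma refuted10_2 : all_refuted cap10 nogoods10_2.
Proof. by_certificate cert10_2 (@refuted10_1). Qed.
Lemma infeasible10 : infeasible cap10.
Proof.
by apply: (@infeasible_corner cap10 z2 z2) => //; apply: refuted10_2; apply: mem_head.
Qed.

Definition cap11 : caps := Eval vm_compute in caps_of (nth [::] box_types 11).
Definition nogoods11_0 : seq shape := [:: (z10, z22); (z0, z3)] :: [::].
Definition cert11_0 := Eval vm_compute in certificate nogoods11_0 cap11.
Lemma refuted11_0 : all_refuted cap11 nogoods11_0.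
Proof. by_certificate cert11_0 (@refuted_nil cap11). Qed.
Definition nogoods11_1 : seq shape := [:: (z10, z9); (z0, z3)] :: nogoods11_0.
Definition cert11_1 := Eval vm_compute in certificate nogoods11_1 cap11.
Lemma refuted11_1 : all_refuted cap11 nogoods11_1.
Proof. by_certificate cert11_1 (@refuted11_0). Qed.
Definition nogoods11_2 : seq shape := [:: (z0, z3)] :: nogoods11_1.
Definition cert11_2 := Eval vm_compute in certificate nogoods11_2 cap11.
Lemma refuted11_2 : all_refuted cap11 nogoods11_2.
Proof. by_certificate cert11_2 (@refuted11_1). Qed.
Lemma infeasible11 : infeasible cap11.
Proof.
by apply: (@infeasible_corner cap11 z0 z3) => //; apply: refuted11_2; apply: mem_head.
Qed.

Definition cap12 : caps := Eval vm_compute in caps_of (nth [::] box_types 12).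
Definition nogoods12_0 : seq shape := [:: (z10, z9); (z0, z2)] :: [::].
Definition cert12_0 := Eval vm_compute in certificate nogoods12_0 cap12.
Lemma refuted12_0 : all_refuted cap12 nogoods12_0.
Proof. by_certificate cert12_0 (@refuted_nil cap12). Qed.
Definition nogoods12_1 : seq shape := [:: (z10, z23); (z0, z2)] :: nogoods12_0.
Definition cert12_1 := Eval vm_compute in certificate nogoods12_1 cap12.
Lemma refuted12_1 : all_refuted cap12 nogoods12_1.
Proof. by_certificate cert12_1 (@refuted12_0). Qed.
Definition nogoods12_2 : seq shape := [:: (z0, z2)] :: nogoods12_1.
Definition cert12_2 := Eval vm_compute in certificate nogoods12_2 cap12.
Lemma refuted12_2 : all_refuted cap12 nogoods12_2.
Proof. by_certificate cert12_2 (@refuted12_1). Qed.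
Lemma infeasible12 : infeasible cap12.
Proof.
by apply: (@infeasible_corner cap12 z0 z2) => //; apply: refuted12_2; apply: mem_head.
Qed.

Definition cap13 : caps := Eval vm_compute in caps_of (nth [::] box_types 13).
Definition nogoods13_0 : seq shape := [:: (z10, z17); (z0, z3)] :: [::].
Definition cert13_0 := Eval vm_compute in certificate nogoods13_0 cap13.
Lemma refuted13_0 : all_refuted cap13 nogoods13_0.
Proof. by_certificate cert13_0 (@refuted_nil cap13). Qed.
Definition nogoods13_1 : seq shape := [:: (z10, z19); (z0, z3)] :: nogoods13_0.
Definition cert13_1 := Eval vm_compute in certificate nogoods13_1 cap13.
Lemma refuted13_1 : all_refuted cap13 nogoods13_1.
Proof. by_certificate cert13_1 (@refuted13_0). Qed.
Definition nogoods13_2 : seq shape := [:: (z0, z3)] :: nogoods13_1.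
Definition cert13_2 := Eval vm_compute in certificate nogoods13_2 cap13.
Lemma refuted13_2 : all_refuted cap13 nogoods13_2.
Proof. by_certificate cert13_2 (@refuted13_1). Qed.
Lemma infeasible13 : infeasible cap13.
Proof.
by apply: (@infeasible_corner cap13 z0 z3) => //; apply: refuted13_2; apply: mem_head.
Qed.

Definition cap14 : caps := Eval vm_compute in caps_of (nth [::] box_types 14).
Definition nogoods14_0 : seq shape := [:: (z7, z10); (z2, z3)] :: [::].
Definition cert14_0 := Eval vm_compute in certificate nogoods14_0 cap14.
Lemma refuted14_0 : all_refuted cap14 nogoods14_0.
Proof. by_certificate cert14_0 (@refuted_nil cap14). Qed.
Definition nogoods14_1 : seq shape := [:: (z7, z19); (z2, z3)] :: nogoods14_0.
Definition cert14_1 := Eval vm_compute in certificate nogoods14_1 cap14.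
Lemma refuted14_1 : all_refuted cap14 nogoods14_1.
Proof. by_certificate cert14_1 (@refuted14_0). Qed.
Definition nogoods14_2 : seq shape := [:: (z2, z3)] :: nogoods14_1.
Definition cert14_2 := Eval vm_compute in certificate nogoods14_2 cap14.
Lemma refuted14_2 : all_refuted cap14 nogoods14_2.
Proof. by_certificate cert14_2 (@refuted14_1). Qed.
Lemma infeasible14 : infeasible cap14.
Proof.
by apply: (@infeasible_corner cap14 z2 z3) => //; apply: refuted14_2; apply: mem_head.
Qed.

Definition cap15 : caps := Eval vm_compute in caps_of (nth [::] box_types 15).
(** From this type on, the corner queen is refuted directly. *)
Definition nogoods15_0 : seq shape := [:: (z0, z3)] :: [::].
Definition cert15_0 := Eval vm_compute in certificate nogoods15_0 cap15.
Lemma refuted15_0 : all_refuted cap15 nogoods15_0.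
Proof. by_certificate cert15_0 (@refuted_nil cap15). Qed.
Lemma infeasible15 : infeasible cap15.
Proof.
by apply: (@infeasible_corner cap15 z0 z3) => //; apply: refuted15_0; apply: mem_head.
Qed.

Definition cap16 : caps := Eval vm_compute in caps_of (nth [::] box_types 16).
Definition nogoods16_0 : seq shape := [:: (z0, z3)] :: [::].
Definition cert16_0 := Eval vm_compute in certificate nogoods16_0 cap16.
Lemma refuted16_0 : all_refuted cap16 nogoods16_0.
Proof. by_certificate cert16_0 (@refuted_nil cap16). Qed.
Lemma infeasible16 : infeasible cap16.
Proof.
by apply: (@infeasible_corner cap16 z0 z3) => //; apply: refuted16_0; apply: mem_head.
Qed.

Definition cap17 : caps := Eval vm_compute in caps_of (nth [::] box_types 17).
Definition nogoods17_0 : seq shape := [:: (z0, z3)] :: [::].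
Definition cert17_0 := Eval vm_compute in certificate nogoods17_0 cap17.
Lemma refuted17_0 : all_refuted cap17 nogoods17_0.
Proof. by_certificate cert17_0 (@refuted_nil cap17). Qed.
Lemma infeasible17 : infeasible cap17.
Proof.
by apply: (@infeasible_corner cap17 z0 z3) => //; apply: refuted17_0; apply: mem_head.
Qed.

Definition cap18 : caps := Eval vm_compute in caps_of (nth [::] box_types 18).
Definition nogoods18_0 : seq shape := [:: (z0, z3)] :: [::].
Definition cert18_0 := Eval vm_compute in certificate nogoods18_0 cap18.
Lemma refuted18_0 : all_refuted cap18 nogoods18_0.
Proof. by_certificate cert18_0 (@refuted_nil cap18). Qed.
Lemma infeasible18 : infeasible cap18.
Proof.
by apply: (@infeasible_corner cap18 z0 z3) => //; apply: refuted18_0; apply: mem_head.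
Qed.

Definition cap19 : caps := Eval vm_compute in caps_of (nth [::] box_types 19).
Definition nogoods19_0 : seq shape := [:: (z0, z3)] :: [::].
Definition cert19_0 := Eval vm_compute in certificate nogoods19_0 cap19.
Lemma refuted19_0 : all_refuted cap19 nogoods19_0.
Proof. by_certificate cert19_0 (@refuted_nil cap19). Qed.
Lemma infeasible19 : infeasible cap19.
Proof.
by apply: (@infeasible_corner cap19 z0 z3) => //; apply: refuted19_0; apply: mem_head.
Qed.

Definition cap20 : caps := Eval vm_compute in caps_of (nth [::] box_types 20).
Definition nogoods20_0 : seq shape := [:: (z0, z4)] :: [::].
Definition cert20_0 := Eval vm_compute in certificate nogoods20_0 cap20.
Lemma refuted20_0 : all_refuted cap20 nogoods20_0.
Proof. by_certificate cert20_0 (@refuted_nil cap20). Qed.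
Lemma infeasible20 : infeasible cap20.
Proof.
by apply: (@infeasible_corner cap20 z0 z4) => //; apply: refuted20_0; apply: mem_head.
Qed.

Definition cap21 : caps := Eval vm_compute in caps_of (nth [::] box_types 21).
Definition nogoods21_0 : seq shape := [:: (z0, z4)] :: [::].
Definition cert21_0 := Eval vm_compute in certificate nogoods21_0 cap21.
Lemma refuted21_0 : all_refuted cap21 nogoods21_0.
Proof. by_certificate cert21_0 (@refuted_nil cap21). Qed.
Lemma infeasible21 : infeasible cap21.
Proof.
by apply: (@infeasible_corner cap21 z0 z4) => //; apply: refuted21_0; apply: mem_head.
Qed.

Definition cap22 : caps := Eval vm_compute in caps_of (nth [::] box_types 22).
Definition nogoods22_0 : seq shape := [:: (z0, z4)] :: [::].
Definition cert22_0 := Eval vm_compute in certificate nogoods22_0 cap22.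
Lemma refuted22_0 : all_refuted cap22 nogoods22_0.
Proof. by_certificate cert22_0 (@refuted_nil cap22). Qed.
Lemma infeasible22 : infeasible cap22.
Proof.
by apply: (@infeasible_corner cap22 z0 z4) => //; apply: refuted22_0; apply: mem_head.
Qed.

Lemma box_types_infeasible l : l \in box_types -> infeasible (caps_of l).
Proof.
rewrite /box_types in_cons => /predU1P[->|]; first exact: infeasible0.
rewrite in_cons => /predU1P[->|]; first exact: infeasible1.
rewrite in_cons => /predU1P[->|]; first exact: infeasible2.
rewrite in_cons => /predU1P[->|]; first exact: infeasible3.
rewrite in_cons => /predU1P[->|]; first exact: infeasible4.
rewrite in_cons => /predU1P[->|]; first exact: infeasible5.
rewrite in_cons => /predU1P[->|]; first exact: infeasible6.
rewrite in_cons => /predU1P[->|]; first exact: infeasible7.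
rewrite in_cons => /predU1P[->|]; first exact: infeasible8.
rewrite in_cons => /predU1P[->|]; first exact: infeasible9.
rewrite in_cons => /predU1P[->|]; first exact: infeasible10.
rewrite in_cons => /predU1P[->|]; first exact: infeasible11.
rewrite in_cons => /predU1P[->|]; first exact: infeasible12.
rewrite in_cons => /predU1P[->|]; first exact: infeasible13.
rewrite in_cons => /predU1P[->|]; first exact: infeasible14.
rewrite in_cons => /predU1P[->|]; first exact: infeasible15.
rewrite in_cons => /predU1P[->|]; first exact: infeasible16.
rewrite in_cons => /predU1P[->|]; first exact: infeasible17.
rewrite in_cons => /predU1P[->|]; first exact: infeasible18.
rewrite in_cons => /predU1P[->|]; first exact: infeasible19.
rewrite in_cons => /predU1P[->|]; first exact: infeasible20.
rewrite in_cons => /predU1P[->|]; first exact: infeasible21.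
rewrite in_cons => /predU1P[->|]; first exact: infeasible22.
by [].
Qed.

(** * From permutations to good maps, and the explicit permutation *)

Definition rz (i : Z25) : z25 := ofn (val i).
Lemma zrK : cancel zr rz. Proof. by case. Qed.
Lemma rzK : cancel rz zr.
Proof.
move=> i; apply: val_inj => /=; rewrite /rz.
have hi : val i < 25 by apply: (ltn_ord i).
have: all (fun n => ton (ofn n) %% 25 == n) (iota 0 25) by vm_compute.
by move/allP/(_ (val i)); rewrite mem_iota => /(_ hi) /eqP.
Qed.

Section NoInvariantSet.
Variable pi : {perm Z25}.
Hypothesis no_set : forall (A : {set Z25}) (i : Z25), 2 <= #|A| <= 7 -> pi @: A <> translate A i.
Let p (z : z25) : z25 := rz (pi (zr z)).
Let zrp z : zr (p z) = pi (zr z). Proof. exact: rzK. Qed.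

(** One inclusion suffices, as both sets have as many elements as A. *)
Lemma image_translate (A : {set Z25}) (i : Z25) :
  (forall a, a \in A -> (pi a - i)%R \in A) -> pi @: A = translate A i.
Proof.
move=> h; apply/eqP; rewrite eqEcard; apply/andP; split.
  apply/subsetP=> y /imsetP[a aA ->]; apply/imsetP; exists (pi a - i)%R; first exact: h.
  by rewrite GRing.subrK.
by rewrite /translate !card_imset //; [apply: GRing.addIr|apply: perm_inj].
Qed.

Lemma stable_card (A : {set Z25}) (i : Z25) :
  (forall a, a \in A -> (pi a - i)%R \in A) -> 2 <= #|A| <= 7 -> False.
Proof. by move=> /image_translate h /no_set /(_ h). Qed.

(** A failure of a clause yields a stable set: two points with equal difference are fixed by z -> pi
    z - i for a suitable i, two points with equal sum are exchanged, and a short cycle is its own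
    stable set. *)
Lemma good_perm : good p.
Proof.
split.
- by move=> x y e; apply: zr_inj; apply: (@perm_inj _ pi); rewrite -!zrp e.
- move=> x y /(congr1 zr); rewrite !zrB !zrp => e.
  apply/eqP/negPn/negP=> xy.
  apply: (@stable_card [set zr x; zr y] (pi (zr x) - zr x)%R); last first.
    by rewrite cards2 (inj_eq zr_inj) xy.
  move=> a /set2P[->|->]; first by rewrite GRing.subKr set21.
  by rewrite e GRing.subKr set22.
- move=> x y /(congr1 zr); rewrite !zrD !zrp => e.
  apply/eqP/negPn/negP=> xy.
  apply: (@stable_card [set zr x; zr y] (pi (zr x) - zr y)%R); last first.
    by rewrite cards2 (inj_eq zr_inj) xy.
  move=> a /set2P[->|->]; first by rewrite GRing.subKr set22.
  have -> : (pi (zr y) - (pi (zr x) - zr y) = (zr y + pi (zr y)) - pi (zr x))%R by ring.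
  by rewrite -e GRing.addrK set21.
move=> i x m hm; set f := fun z => zsub (p z) i => e.
apply/eqP/negPn/negP=> fx.
have m1 : 1 < m.
  by case: m hm e => [//|[|//]] _ /= h; rewrite -/(f x) h eqxx in fx.
have m0 := ltnW m1.
(* The iterates may repeat if m is not the exact period; only 2 <= |A| <= m is used. *)
pose A : {set Z25} := [set zr (iter (j : 'I_m) f x) | j : 'I_m].
have memA j : j < m -> zr (iter j f x) \in A.
  by move=> hj; apply/imsetP; exists (Ordinal hj).
apply: (@stable_card A (zr i)).
  move=> a /imsetP[j _ ->]; rewrite -zrp -zrB -[zsub _ _]/(iter j.+1 f x).
  have [->|hj] := eqVneq j.+1 m; first by rewrite e; apply: (memA 0).
  by apply: memA; rewrite ltn_neqAle hj ltn_ord.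
apply/andP; split.
  have /subset_leq_card : [set zr x; zr (f x)] \subset A.
    apply/subsetP=> a /set2P[->|->]; first exact: (memA 0).
    exact: (memA 1).
  by apply: leq_trans; rewrite cards2 (inj_eq zr_inj) eq_sym fx.
apply: leq_trans (leq_imset_card _ _) _; rewrite cardT size_enum_ord.
by case/andP: hm.
Qed.
End NoInvariantSet.

(* Found by a search among the permutations that commute with [x |-> 7 x]. *)
Definition witness_values : seq nat := [:: 0; 2; 21; 12; 16; 8; 20; 14; 10; 24; 6; 3; 7;
  18; 22; 19; 1; 15; 11; 5; 17; 9; 13; 4; 23].
Definition witness_fun (z : z25) : z25 := ofn (nth 0 witness_values (ton z)).
Lemma witness_inj : injective (fun i : Z25 => zr (witness_fun (rz i)) : Z25).
Proof.
move=> i j /zr_inj /eqP h; apply: (can_inj rzK); apply/eqP; move: h; apply/implyP.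
by move: (rz i) (rz j); apply: brute2; vm_compute.
Qed.
Definition witness : {perm Z25} := perm witness_inj.

Lemma witness_diff : injective (fun x : Z25 => (witness x - x)%R).
Proof.
move=> i j; rewrite /= !permE -[in X in (_ - X)%R](rzK i) -[in X in _ = (_ - X)%R](rzK j).
rewrite -!zrB => /zr_inj /eqP h; apply: (can_inj rzK); apply/eqP; move: h; apply/implyP.
by move: (rz i) (rz j); apply: brute2; vm_compute.
Qed.

(** Evaluation over all shifts and points shows that a point returning after 2 to 6 steps is fixed,
    whereas an orbit of at least two points would then list x twice. *)
Lemma witness_cycles k : no_short_cycle (shifted witness k).
Proof.
move=> x; set f := shifted witness k => /andP[h2 h6].
have fI : injective f by move=> a b /perm_inj /GRing.addIr.
pose g z := witness_fun (zadd z (rz k)).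
have fz z : f (zr z) = zr (g z).
  by rewrite /f /shifted -[k](rzK k) -zrD permE /g zrK ?rzK.
have iterf n z : iter n f (zr z) = zr (iter n g z) by elim: n => //= n ->.
have fx : f x = x.
  have /eqP := iter_order fI x; rewrite -(rzK x) iterf (inj_eq zr_inj) fz => hx.
  congr zr; apply/eqP; move: hx; rewrite rzK.
  have: fingraph.order f x \in iota 2 5 by rewrite mem_iota h2.
  move: (fingraph.order f x) => n hn; apply/implyP; rewrite /g; move: (rz k) (rz x) => c z.
  suff: all (fun n => (iter n (fun z => witness_fun (zadd z c)) z == z) ==>
    (witness_fun (zadd z c) == z)) (iota 2 5) by move/allP/(_ n hn).
  by move: c z; apply: brute2; vm_compute.
have := fingraph.orbit_uniq f x; rewrite /fingraph.orbit.
by case: (fingraph.order f x) h2 => [//|[//|n]] _; rewrite /= inE fx eqxx.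
Qed.

Lemma proposition_of_infeasible :
  (forall l, l \in box_types -> infeasible (caps_of l)) ->
  (forall pi : {perm Z25}, exists (A : {set Z25}) (i : Z25),
      2 <= #|A| <= 7 /\ pi @: A = translate A i) /\
  (exists pi : {perm Z25},
      injective (fun x : Z25 => (pi x - x)%R) /\
      forall k : Z25, no_short_cycle (shifted pi k)).
Proof.
move=> hinf; split; last by exists witness; split; [apply: witness_diff|apply: witness_cycles].
move=> pi.
case: (boolP [exists A : {set Z25}, exists i : Z25,
    (2 <= #|A| <= 7) && (pi @: A == translate A i)]).
  by case/existsP=> A /existsP[i /andP[h /eqP e]]; exists A, i.
rewrite negb_exists => /forallP h; case: (no_good hinf (good_perm (pi := pi) _)).
move=> A i hA e; have := h A; rewrite negb_exists => /forallP /(_ i).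
by rewrite hA e eqxx.
Qed.

Local Open Scope ring_scope.

Theorem proposition6p1 :
  (forall pi : {perm Z25}, exists (A : {set Z25}) (i : Z25),
      (2 <= #|A| <= 7)%N /\ pi @: A = translate A i) /\
  (exists pi : {perm Z25},
      injective (fun x : Z25 => pi x - x) /\
      forall k : Z25, no_short_cycle (shifted pi k)).
Proof. exact: proposition_of_infeasible box_types_infeasible. Qed.
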